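(* For $0<\nu<1/2$ and $0<\epsilon<L<\infty$ let $B_{\nu,\epsilon,L}$ be the class of step functions $\mu$ on $[0,1)$ with $\lambda_\mu\ge\nu$ and, if $K_\mu\ge1$, $\epsilon\le\Delta_\mu\le\tilde\Delta_\mu\le L$. Let $\hat\mu_{n,\alpha_n}$ be the FDRSeg estimator with parameter $\alpha=\alpha_n$ computed from $n$ observations $Y_i=\mu(i/n)+\sigma\varepsilon_i$, $i=0,\dots,n-1$, $\varepsilon_i$ independent standard normal, $\sigma>0$ known. (i) If $\alpha_n\gtrsim 1/n$ and $\alpha_n=o\left(\frac{1}{\sqrt n}\left(\frac{\log n}{n}\right)^{\min\{1/2,1/p\}}\right)$, then $$\limsup_{n\to\infty}\sup_{\mu\in B_{\nu,\epsilon,L}}\mathbf{E}\left[\|\hat\mu_{n,\alpha_n}-\mu\|_{L^p}\right]\left(\frac{\nu\epsilon^2n}{\sigma^2\log n}\right)^{\min\{1/2,1/p\}}\le 25L,$$ for any $\sigma>0$, $0<\nu<1/2$, $0<\epsilon<L<\infty$ and $1\le p<\infty$. (ii) If $an^{-\gamma}\le\nu:=\nu_n\le bn^{-\gamma}$ with constants $a,b>0$, $0<\gamma<1$, and $\alpha_n\gtrsim n^{-3/2}$ and $\alpha_n=o\left(\frac{1}{n^{\gamma+1/2}}\left(\frac{\log n}{n^{1-\gamma}}\right)^{\min\{1/2,1/p\}}\right)$, then $$\limsup_{n\to\infty}\sup_{\mu\in B_{\nu_n,\epsilon,L}}\mathbf{E}\left[\|\hat\mu_{n,\alpha_n}-\mu\|_{L^p}\right]\left(\frac{\epsilon^2n^{1-\gamma}}{\sigma^2\log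 n}\right)^{\min\{1/2,1/p\}}\le 34L,$$ for any $a,b,\sigma>0$, $0<\gamma<1$, $0<\epsilon<L<\infty$ and $1\le p<\infty$.
   Context: Step functions: $\mu=\sum_{k=0}^{K}c_k\mathbf{1}_{[\tau_k,\tau_{k+1})}$ with $0=\tau_0<\tau_1<\dots<\tau_K<\tau_{K+1}=1$ and $c_k\ne c_{k+1}$; $K=K_\mu$ is the number of change-points. $\lambda_\mu=\min_{0\le k\le K}|\tau_{k+1}-\tau_k|$; if $K_\mu\ge1$, $\Delta_\mu=\min_{1\le k\le K}|c_k-c_{k-1}|$ and $\tilde\Delta_\mu=\max_{1\le k\le K}|c_k-c_{k-1}|$. $\|\cdot\|_{L^p}$ is the norm of $L^p([0,1))$. $a_n\gtrsim b_n$ means $a_n\ge c\,b_n$ for some constant $c>0$ and all $n$. Multiscale statistic: for an interval $I\subset[0,1)$ let $\#I$ be the number of sampling points $i/n$ ($0\le i\le n-1$) in $I$. For $c\in\mathbb{R}$, $$T_I(Y,c)=\max_{[i/n,j/n]\subset I}\left\{\frac{\left|\sum_{l=i}^{j}(Y_l-c)\right|}{\sigma\sqrt{j-i+1}}-\mathrm{pen}\left(\frac{j-i+1}{\#I}\right)\right\},\qquad \mathrm{pen}(x)=\sqrt{2\log(e/x)},$$ the maximum being over integers $0\le i\le j\le n-1$. Local quantiles: for $\alpha\in(0,1)$ and $1\le m\le n$, $$q_\alpha(m)=\min\{q:\mathbb{P}\{T_I(\varepsilon,\bar\varepsilon_I)>q\}\le\alpha\},$$ where $\varepsilon=(\varepsilon_0,\dots,\varepsilon_{n-1})$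 is standard normal (here $T_I$ is computed with $\sigma=1$), $I$ is any fixed interval with $\#I=m$, and $\bar\varepsilon_I=\frac{1}{\#I}\sum_{i/n\in I}\varepsilon_i$. FDRSeg with parameter $\alpha$: for $k\ge0$ let $$\mathcal{C}_k=\left\{\sum_{i=0}^{k}c_i\mathbf{1}_{I_i}: T_{I_i}(Y,c_i)\le q_\alpha(\#I_i)\ \text{ for all } i=0,\dots,k\right\},$$ where $I_0,\dots,I_k$ run over partitions of $[0,1)$ into $k+1$ consecutive intervals $[a/n,b/n)$ with integers $a<b$. Then $\hat K:=\min\{k:\mathcal{C}_k\neq\emptyset\}$ and the FDRSeg estimator is $\hat\mu\in\arg\min_{\mu\in\mathcal{C}_{\hat K}}\sum_{i=0}^{n-1}(Y_i-\mu(i/n))^2$. *)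

(* Defs.v *)
From HB Require Import structures.
From mathcomp Require Import all_boot all_order all_algebra.
From mathcomp Require Import all_classical all_reals all_analysis.

Set Implicit Arguments.
Unset Strict Implicit.
Unset Printing Implicit Defensive.

Import Order.TTheory GRing.Theory Num.Theory.
Import numFieldNormedType.Exports.

Local Open Scope classical_set_scope.
Local Open Scope ring_scope.

(* Only tau 0, ..., tau (K + 1) and c 0, ..., c K are meaningful. *)
Record stepfun (R : realType) := StepFun {
  nchange : nat;
  tau : nat -> R;
  level : nat -> R;
  tau_first : tau 0%N = 0;
  tau_last : tau nchange.+1 = 1;
  tau_lt : forall k, (k <= nchange)%N -> tau k < tau k.+1;
  level_neq : forall k, (k < nchange)%N -> level k != level k.+1 }.

Section StepFunctions.
Context {R : realType}.
Implicit Types (mu : stepfun R) (k : nat).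

Definition stepval mu (x : R) : R :=
  \sum_(k < (nchange mu).+1) level mu k * \1_(`[tau mu k, tau mu k.+1[) x.

Definition gap mu k : R := `|tau mu k.+1 - tau mu k|.

Definition jump mu k : R := `|level mu k - level mu k.-1|.

Definition min_gap mu : R :=
  \big[Num.min/gap mu 0%N]_(0 <= k < (nchange mu).+1) gap mu k.

(* min_jump and max_jump are meaningful only when there is a change-point. *)
Definition min_jump mu : R :=
  \big[Num.min/jump mu 1%N]_(1 <= k < (nchange mu).+1) jump mu k.

Definition max_jump mu : R :=
  \big[Num.max/jump mu 1%N]_(1 <= k < (nchange mu).+1) jump mu k.

Definition stepclass (nu epsilon L : R) : set (stepfun R) :=
  [set mu | nu <= min_gap mu /\
    ((1 <= nchange mu)%N ->
      [/\ epsilon <= min_jump mu, min_jump mu <= max_jump mu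
        & max_jump mu <= L])].

End StepFunctions.

Section FDRSeg.
Context {R : realType}.

Definition grid (n i : nat) : R := i%:R / n%:R.

Definition npoints (n : nat) (I : set R) : nat :=
  #|[pred i : 'I_n | grid n i \in I]|.

Definition pen (x : R) : R := Num.sqrt (2 * ln (expR 1 / x)).

(* The set is finite, and nonempty when I contains a sampling point, so that
   the supremum is then a maximum. *)
Definition multiscale (sigma : R) (n : nat) (I : set R) (Y : n.-tuple R)
    (c : R) : R :=
  sup [set x | exists i j : 'I_n,
    [/\ (i <= j)%N, `[grid n i, grid n j] `<=` I
      & x = `|\sum_(l < n | (i <= l <= j)%N) (tnth Y l - c)|
              / (sigma * Num.sqrt (j - i).+1%:R)
            - pen ((j - i).+1%:R / (npoints n I)%:R)]].

Definition local_mean (n : nat) (I : set R) (Y : n.-tuple R) : R :=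
  (\sum_(i < n | grid n i \in I) tnth Y i) / (npoints n I)%:R.

(* The interval with m sampling points is taken to be [0, m/n), and the
   standard normal vector e is an argument: the value depends only on its law.
   For 0 < alpha < 1 the infimum is attained, because q |-> P(T > q) is
   right-continuous. *)
Definition local_quantile d (Omega : measurableType d) (P : probability Omega R)
    (n : nat) (e : 'I_n -> Omega -> R) (alpha : R) (m : nat) : R :=
  let I := `[0, grid n m[%classic in
  let E w := [tuple e i w | i < n] in
  inf [set q : R |
    (P [set w | (q < multiscale 1 I (E w) (local_mean I (E w)))%R]
       <= alpha%:E)%E].

(* The breakpoints b 0 = 0 < b 1 < ... < b (k + 1) = n encode the partition
   of [0, 1) into the intervals [b i / n, b i.+1 / n), 0 <= i <= k. *)
Definition candidates (sigma : R) (q : nat -> R) (n : nat) (Y : n.-tuple R)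
    (k : nat) : set (R -> R) :=
  [set f | exists (b : nat -> nat) (c : nat -> R),
    let I i := `[grid n (b i), grid n (b i.+1)[%classic in
    [/\ b 0%N = 0%N, b k.+1 = n, (forall i, (i <= k)%N -> (b i < b i.+1)%N),
        (forall i, (i <= k)%N ->
           multiscale sigma (I i) Y (c i) <= q (npoints n (I i)))
      & f = (fun x => \sum_(i < k.+1) c i * \1_(I i) x)]].

Definition rss (n : nat) (Y : n.-tuple R) (f : R -> R) : R :=
  \sum_(i < n) (tnth Y i - f (grid n i)) ^+ 2.

Definition is_FDRSeg (sigma : R) (q : nat -> R) (n : nat) (Y : n.-tuple R)
    (f : R -> R) : Prop :=
  exists Khat : nat,
    [/\ candidates sigma q Y Khat !=set0,
        (forall k, candidates sigma q Y k !=set0 -> (Khat <= k)%N),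
        candidates sigma q Y Khat f
      & (forall g, candidates sigma q Y Khat g -> rss Y f <= rss Y g)].

(* The sequence of estimators is a sequence of statistics (measurable functions
   of the n observations); any selection of the minimizer is allowed. *)
Definition FDRSeg_estimator d (Omega : measurableType d)
    (P : probability Omega R) (eps : forall n, 'I_n -> Omega -> R) (sigma : R)
    (alpha : nat -> R) (muhat : forall n, n.-tuple R -> R -> R) : Prop :=
  forall n, (0 < n)%N ->
    (forall Y, is_FDRSeg sigma (local_quantile P (eps n) (alpha n)) Y
                 (muhat n Y)) /\
    (forall x, measurable_fun [set: n.-tuple R] (fun Y => muhat n Y x)).

End FDRSeg.

Section Risk.
Context {R : realType} d (Omega : measurableType d) (P : probability Omega R).

Definition independent_RVs (n : nat) (X : 'I_n -> {RV P >-> R}) : Prop :=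
  forall (J : {set 'I_n}) (A : 'I_n -> set R),
    (forall i, measurable (A i)) ->
    (P (\bigcap_(i in [set` J]) (X i @^-1` A i))
      = \prod_(i in J) P (X i @^-1` A i))%E.

Definition iid_std_normal (n : nat) (X : 'I_n -> {RV P >-> R}) : Prop :=
  independent_RVs X /\
  (forall i (A : set R), measurable A ->
     distribution P (X i) A = normal_prob 0 1 A).

Definition observations (mu : stepfun R) (sigma : R) (n : nat)
    (e : 'I_n -> Omega -> R) (w : Omega) : n.-tuple R :=
  [tuple stepval mu (grid n i) + sigma * e i w | i < n].

Definition Lp_norm01 (p : R) (f : R -> R) : \bar R :=
  Lnorm (mrestr (@lebesgue_measure R) (measurable_itv `[0, 1[)) p%:E
    (EFin \o f).

Definition Lp_risk (p sigma : R) (n : nat) (e : 'I_n -> Omega -> R)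
    (est : n.-tuple R -> R -> R) (mu : stepfun R) : \bar R :=
  (\int[P]_w Lp_norm01 p
     (fun x => est (observations mu sigma e w) x - stepval mu x)%R)%E.

Definition sup_risk (B : set (stepfun R)) (p sigma : R) (n : nat)
    (e : 'I_n -> Omega -> R) (est : n.-tuple R -> R -> R) : \bar R :=
  ereal_sup [set Lp_risk p sigma e est mu | mu in B].

End Risk.

Definition asymp_ge (R : realType) (u v : nat -> R) : Prop :=
  exists2 C : R, 0 < C & forall n, (0 < n)%N -> C * v n <= u n.

(* Main.v *)
(* Write chi(a, b) for the noise summed over the sampling points a, ..., b - 1
   and divided by sqrt (b - a), and T for sqrt (8 ln n). Up to an event of
   negligible expected loss, |chi(a, b)| <= T for all windows, and the partition
   of the true signal, with its segment means, satisfies the multiscale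
   constraints: by translation invariance of the noise each segment fails with
   probability at most alpha_n. Then the estimator has at most K change-points;
   a segment of the estimator containing a true change-point far from both ends
   would violate a constraint, so every true change-point is matched within
   r = O(ln n) sampling points and the estimator has exactly K change-points.

   Since it minimises the residual sum of squares, the estimator beats the true
   signal in that respect, and Cauchy-Schwarz on the common refinement of the
   two partitions bounds the squared error by 4 sigma^2 times the sum of
   chi(a, b)^2 over the 3 (K + 1) pieces of the refinement. Each piece belongs
   to a family of O(r^2) windows, and chi^2 <= x + (6!/x^2)(e^chi + e^-chi) with
   x = eta ln n turns the sum into (K + 1)(3 eta ln n + O(1)) in expectation.
   As eta is arbitrary, the normalised risk tends to 0 in both regimes; neither
   a nor b matters, and the constants 25 and 34 are not needed.
   Part (i) is the case gamma = 0 of the argument for part (ii). *)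
Require Import Defs.
From mathcomp Require Import all_boot all_order all_algebra.
From mathcomp Require Import all_classical all_reals all_analysis.
From mathcomp Require Import measurable_realfun measurable_fun_approximation.
From mathcomp Require Import ring lra zify.

Set Implicit Arguments.
Unset Strict Implicit.
Unset Printing Implicit Defensive.

Import Order.TTheory GRing.Theory Num.Theory.
Import numFieldNormedType.Exports.
Import HBNNSimple.

Local Open Scope classical_set_scope.
Local Open Scope ring_scope.

(** The bound |chi| <= T alone gives chi^2 <= 8 ln n on each piece, which has the order of the rate
    but a constant that need not be small. The ends of a piece depend on the estimator, yet each
    lies within r of a known sampling point; this leaves O(r^2) = O((ln n)^2) possible pieces per
    segment, a list fixed in advance. The exponent 6 matches this count: after division by x^2 the
    sum over the list costs O(1) per segment, against the main term 3 eta ln n.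

    The conditions on alpha_n act on the exceptional events. The lower bound makes the quantiles at
    most 2T, because a window of noise exceeds T with probability O(n^-2) only. The upper bound,
    multiplied by the number of segments (at most 1/nu), keeps the probability that a true segment
    fails below a multiple of n^(-1/2) times the rate, so that a loss of order T there is
    negligible.

    The exponent min(1/2, 1/p) comes from passing from the squared error to the L^p norm of a
    bounded function: for p >= 2 a factor |f|^(p-2) is bounded, for p < 2 the L^2 norm dominates. *)

(* The loss is not known to be a measurable function of the sample point, hence
   a comparison of integrals that requires no measurability. *)
Lemma ge0_le_integralT d (T : measurableType d) (R : realType)
    (m : {measure set T -> \bar R}) (f g : T -> \bar R) :
  (forall x, 0 <= f x)%E -> (forall x, f x <= g x)%E ->
  (\int[m]_x f x <= \int[m]_x g x)%E.
Proof.
move=> f0 fg; have g0 x : (0 <= g x)%E by exact: le_trans (f0 x) (fg x).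
rewrite !ge0_integralTE//; apply: ge_ereal_sup => _ [h hf <-].
by apply: ereal_sup_ubound => /=; exists h => // x; exact: le_trans (hf x) (fg x).
Qed.

(** * Gaussian windows *)

Section WeightedIntegral.
Context {R : realType} d d' (T : measurableType d) (T' : measurableType d').
Variables (m : {measure set T -> \bar R}) (m' : probability T' R).
Variables (X : T -> T') (g : T -> R) (c : R).
Hypotheses (mX : measurable_fun setT X) (mg : measurable_fun setT g).
Hypotheses (g0 : forall w, 0 <= g w) (c0 : 0 <= c).
Hypothesis gX : forall A, measurable A ->
  (\int[m]_w (g w * \1_A (X w))%:E = c%:E * m' A)%E.

(** Hypothesis [gX] says that the image under [X] of the measure with density [g] is [c * m']. It
    serves for a change of density, and also with [g] a product of factors independent of [X]. *)
Lemma integral_weighted_nnsfun (h : {nnsfun T' >-> R}) :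
  (\int[m]_w (g w * h (X w))%:E = c%:E * \int[m']_y (h y)%:E)%E.
Proof.
have mh k : measurable (h @^-1` [set k]) by exact: measurable_sfunP.
have mI k : measurable_fun setT (fun w => \1_(h @^-1` [set k]) (X w) : R).
  by apply: measurableT_comp => //; exact: measurable_indic.
have hE y : h y = \sum_(k \in range h) (k * \1_(h @^-1` [set k]) y).
  by rewrite {1}(fimfunE h).
have range_ge0 k : range h k -> 0 <= k by move=> [x _ <-].
have step_ge0 k y : 0 <= k * \1_(h @^-1` [set k]) y.
  have [kr|kr] := pselect (range h k).
    by rewrite mulr_ge0// ?range_ge0// indicE.
  by rewrite indicE memNset ?mulr0// => /= hk; apply: kr; exists y.
have finr : finite_set (range h) by exact: fimfunP.
have -> : (\int[m]_w (g w * h (X w))%:E =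
  \sum_(k \in range h) (\int[m]_w (k * (g w * \1_(h @^-1` [set k]) (X w)))%:E))%E.
  rewrite -ge0_integral_fsum//.
  - apply: eq_integral => w _; rewrite hE fsumEFin// mulr_fsumr//; congr EFin.
    by apply: eq_fsbigr => k _; rewrite mulrCA.
  - by move=> k; apply/measurable_EFinP; do 2 apply: measurable_funM => //.
  - by move=> k w _; rewrite lee_fin mulrCA mulr_ge0.
have -> : (\int[m']_y (h y)%:E =
  \sum_(k \in range h) (\int[m']_y (k * \1_(h @^-1` [set k]) y)%:E))%E.
  rewrite -ge0_integral_fsum//.
  - by apply: eq_integral => w _; rewrite hE fsumEFin.
  - move=> k; apply/measurable_EFinP; apply: measurable_funM => //.
  - by move=> k w _; rewrite lee_fin.
transitivity (\sum_(k \in range h)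
   ((c * (k * fine (m' (h @^-1` [set k]))))%R)%:E)%E.
  apply: eq_fsbigr => k /[!inE] kr.
  under eq_integral do rewrite EFinM.
  rewrite ge0_integralZl//.
  - rewrite gX// -[X in (_ * (_ * X))%E]fineK ?fin_num_measure//.
    by rewrite -!EFinM; congr EFin; ring.
  - by apply/measurable_EFinP; apply: measurable_funM.
  - by move=> w _; rewrite lee_fin mulr_ge0// indicE.
  - by rewrite lee_fin; apply: range_ge0.
transitivity (c%:E * \sum_(k \in range h)
   (((k * fine (m' (h @^-1` [set k]))))%R)%:E)%E.
  by rewrite !fsumEFin// -EFinM mulr_fsumr.
congr (_ * _)%E; apply: eq_fsbigr => k /[!inE] kr.
under eq_integral do rewrite EFinM.
rewrite ge0_integralZl//.
- by rewrite EFinM fineK ?fin_num_measure// integral_indic// setIT.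
- by apply/measurable_EFinP; exact: measurable_indic.
- by rewrite lee_fin; apply: range_ge0.
Qed.

(* T' is left general because normal_prob lives on measurableTypeR and the
   distribution of a random variable on R itself: these measurable types have the
   same measurable sets but are not convertible. *)
Lemma integral_weighted (f : T' -> R) :
  measurable_fun setT f -> (forall x, 0 <= f x) ->
  (\int[m]_w (g w * f (X w))%:E = c%:E * \int[m']_y (f y)%:E)%E.
Proof.
move=> mf f0.
have mf' : measurable_fun setT (EFin \o f) by exact/measurable_EFinP.
pose h := nnsfun_approx measurableT mf'.
have hf x : (h n x)%:E @[n --> \oo] --> (f x)%:E.
  by apply: cvg_nnsfun_approx => // y _; rewrite lee_fin.
have hnd x m1 m2 : (m1 <= m2)%N -> h m1 x <= h m2 x.
  by move=> mn; exact/lefP/nd_nnsfun_approx.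
have limL : (\int[m]_w (g w * h n (X w))%:E)%E @[n --> \oo] -->
    (\int[m]_w (g w * f (X w))%:E)%E.
  rewrite (_ : (fun w => _) = fun w => limn (fun n => (g w * h n (X w))%:E)).
    apply: cvg_monotone_convergence => //.
    - move=> n; apply/measurable_EFinP; apply: measurable_funM => //.
      by apply: measurableT_comp.
    - by move=> n w _; rewrite lee_fin mulr_ge0.
    - by move=> w _ m1 m2 mn; rewrite lee_fin ler_wpM2l// hnd.
  apply/funext => w; apply/esym/cvg_lim => //; rewrite EFinM.
  under eq_fun do rewrite EFinM.
  by apply: cvgeZl => //; apply: hf.
have limR : (\int[m']_y (h n y)%:E)%E @[n --> \oo] --> (\int[m']_y (f y)%:E)%E.
  rewrite (_ : (fun w => _) = fun y => limn (fun n => (h n y)%:E)).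
    apply: cvg_monotone_convergence => //.
    - by move=> n; apply/measurable_EFinP.
    - by move=> n w _; rewrite lee_fin.
    - by move=> w _ m1 m2 mn; rewrite lee_fin hnd.
  by apply/funext => w; apply/esym/cvg_lim => //; apply: hf.
have limR' : (c%:E * \int[m']_y (h n y)%:E)%E @[n --> \oo] -->
    (c%:E * \int[m']_y (f y)%:E)%E by apply: cvgeZl.
rewrite (_ : (fun n => _) = fun n => (c%:E * \int[m']_y (h n y)%:E)%E) in limL.
  exact: cvg_unique limL limR'.
by apply/funext => n; exact: integral_weighted_nnsfun.
Qed.

End WeightedIntegral.

Lemma integral_normal_probE (R : realType) (f : R -> R) :
  measurable_fun setT f -> (forall x, 0 <= f x) ->
  (\int[normal_prob 0 1]_x (f x)%:E =
   \int[lebesgue_measure]_x (normal_pdf 0 1 x * f x)%:E)%E.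
Proof.
move=> mf f0.
rewrite (@integral_weighted _ _ _ _ _ lebesgue_measure (normal_prob 0 1) id
  (normal_pdf 0 1) 1)// ?mul1e//.
- exact: measurable_normal_pdf.
- exact: normal_pdf_ge0.
- move=> A mA; rewrite mul1e /= /normal_prob [RHS]integral_mkcond.
  apply: eq_integral => x _ /=; rewrite patchE indicE.
  by case: (x \in A); rewrite ?mulr1// mulr0.
Qed.

Lemma normal_prob_mgf (R : realType) (s : R) :
  (\int[normal_prob 0 1]_x (expR (s * x))%:E = (expR (s ^+ 2 / 2))%:E)%E.
Proof.
rewrite integral_normal_probE; last 2 first.
- by apply: measurableT_comp => //; apply: measurable_funM.
- by move=> x; exact: expR_ge0.
(* Completing the square: tilting by [expR (s * x)] moves the mean of the density to [s]. *)
transitivity (\int[@lebesgue_measure R]_x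
    ((expR (s ^+ 2 / 2))%:E * (normal_pdf s 1 x)%:E))%E.
  apply: eq_integral => x _; rewrite -EFinM; congr EFin.
  rewrite /normal_pdf oner_eq0 /normal_fun.
  rewrite [RHS]mulrCA -[LHS]mulrA; congr (_ * _).
  by rewrite -!expRD; congr expR; field.
rewrite ge0_integralZl//.
- by rewrite integral_normal_pdf mule1.
- by apply/measurable_EFinP; exact: measurable_normal_pdf.
- by move=> x _; rewrite lee_fin normal_pdf_ge0.
Qed.


Section Windows.
Context {R : realType}.
Implicit Types (z : nat -> R).

(** The value 0 past [n] extends the noise to all of [nat], so that windows are plain ranges of
    naturals and a window reaching beyond [n] only loses terms. *)
Definition ext n (x : 'I_n -> R) (l : nat) : R :=
  if insub l is Some i then x i else 0.

Definition wsum z (a b : nat) : R := \sum_(a <= l < b) z l.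

(** An empty window gets the value 0, as an empty sum; pieces of a refinement may be empty. *)
Definition chi z (a b : nat) : R := wsum z a b / Num.sqrt (b - a)%:R.

Lemma extE n (x : 'I_n -> R) (i : 'I_n) : ext x i = x i.
Proof. by rewrite /ext valK. Qed.

Lemma ext_Ordinal n (x : 'I_n -> R) l (ln : (l < n)%N) :
  ext x l = x (Ordinal ln).
Proof. by rewrite /ext insubT. Qed.

Lemma ext_out n (x : 'I_n -> R) l : (n <= l)%N -> ext x l = 0.
Proof. by move=> nl; rewrite /ext insubN// -leqNgt. Qed.

Lemma sum_nat_ord (z : nat -> R) n a b : (forall l, (n <= l)%N -> z l = 0) ->
  \sum_(a <= l < b) z l = \sum_(i < n | (a <= i < b)%N) z i.
Proof.
move=> z0.
rewrite -(big_mkord (fun i => (a <= i < b)%N) z).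
rewrite (big_nat_widen 0 n (n + b)) ?leq_addr//.
rewrite (big_nat_widen a b (n + b)) ?leq_addl//.
rewrite (big_nat_widenl a 0)//.
rewrite [LHS](bigID (fun l => (l < n)%N))/= [X in _ + X]big1 ?addr0.
  by apply: eq_bigl => l; lia.
by move=> l; rewrite -leqNgt => /andP[_]; exact: z0.
Qed.

Lemma wsum_ext n (x : 'I_n -> R) a b :
  wsum (ext x) a b = \sum_(i < n | (a <= i < b)%N) x i.
Proof.
rewrite /wsum (sum_nat_ord (n := n)); last by move=> l; exact: ext_out.
by apply: eq_bigr => i _; rewrite extE.
Qed.

End Windows.

Section Independence.
Context {R : realType} d (Omega : measurableType d) (P : probability Omega R).

Lemma measurable_preim_RV (X : {RV P >-> R}) (A : set R) :
  measurable A -> measurable (X @^-1` A).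
Proof. by move=> mA; rewrite -[X @^-1` _]setTI; exact: measurable_funPT. Qed.

Lemma measurable_bigcap_RV n (X : 'I_n -> {RV P >-> R}) (J : {set 'I_n})
    (A : 'I_n -> set R) : (forall i, measurable (A i)) ->
  measurable (\bigcap_(i in [set` J]) (X i @^-1` A i)).
Proof.
move=> mA; apply: fin_bigcap_measurable => [|i _]; first exact: finite_finset.
exact: measurable_preim_RV.
Qed.

(* The indicators are traded for F one index at a time: the indices of s are
   done, those of J are still to be treated. *)
Lemma independent_integral_prod n (X : 'I_n -> {RV P >-> R})
    (F : R -> R) (c : R) :
  independent_RVs X -> measurable_fun setT F -> (forall x, 0 <= F x) -> 0 <= c ->
  (forall i, \int[P]_w (F (X i w))%:E = c%:E)%E ->
  forall (s : seq 'I_n) (J : {set 'I_n}) (A : 'I_n -> set R), uniq s ->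
  (forall i, measurable (A i)) -> (forall i, i \in s -> i \notin J) ->
  (\int[P]_w ((\prod_(i <- s) F (X i w)) * \prod_(i in J) \1_(A i) (X i w))%:E =
   (c ^+ size s)%:E * P (\bigcap_(i in [set` J]) (X i @^-1` A i)))%E.
Proof.
move=> iX mF F0 c0 FX; elim=> [|i s IH] J A /=.
  move=> _ mA _; rewrite expr0 mul1e.
  rewrite -[in RHS](setIT (\bigcap_(i in _) _)) -integral_indic//; last first.
    exact: measurable_bigcap_RV.
  apply: eq_integral => w _; rewrite big_nil mul1r; congr EFin.
  rewrite indicE; have [wA|wA] := boolP (w \in _).
    rewrite big1// => i iJ; rewrite indicE mem_set//.
    by move/set_mem : wA; apply.
  have [i iJ Xi] : exists2 i, i \in J & ~ A i (X i w).
    apply: contrapT => h; move/negP : wA; apply; apply/mem_set => i /= iJ.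
    by apply: contrapT => Ai; apply: h; exists i.
  by rewrite (bigD1 i)//= indicE memNset// mul0r.
move=> /andP[ins us] mA sJ.
have mprod (B : 'I_n -> set R) : (forall i, measurable (B i)) ->
  measurable_fun setT (fun w => (\prod_(i <- s) F (X i w)) *
     \prod_(i in J) \1_(B i) (X i w)).
  move=> mB; apply: measurable_funM.
    by apply: measurable_prod => j _; apply: measurableT_comp.
  under eq_fun do rewrite -big_enum/=.
  by apply: measurable_prod => j _; apply: measurableT_comp => //; exact: measurable_indic.
have ilJ : i \notin J by apply: sJ; rewrite inE eqxx.
under eq_integral do rewrite big_cons -mulrA mulrC.
pose B (D : set R) j := if j == i then D else A j.
have mB D : measurable D -> forall j, measurable (B D j).
  by move=> mD j; rewrite /B; case: ifP.
have PB D : measurable D ->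
  (P (\bigcap_(j in [set` i |: J]) (X j @^-1` B D j)) =
   P (X i @^-1` D) * P (\bigcap_(j in [set` J]) (X j @^-1` A j)))%E.
  move=> mD; rewrite !iX//; last exact: mB.
  rewrite big_setU1//= /B eqxx; congr (_ * _)%E.
  by apply: eq_bigr => j jJ; rewrite ifN//; apply: contraNneq ilJ => <-.
have mcap : measurable (\bigcap_(j in [set` J]) (X j @^-1` A j)).
  exact: measurable_bigcap_RV.
have finP : P (\bigcap_(j in [set` J]) (X j @^-1` A j)) \is a fin_num.
  exact: fin_num_measure.
(* All the factors except [F (X i w)] form the weight. That the law of [X i] under it is a multiple
   of its distribution is the induction hypothesis with [i] moved into [J], combined with
   independence. *)
rewrite (@integral_weighted _ _ _ _ _ P (distribution P (X i)) (X i) _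
   (c ^+ size s * fine (P (\bigcap_(j in [set` J]) (X j @^-1` A j)))))//.
- have -> : (\int[distribution P (X i)]_y (F y)%:E = c%:E)%E.
    rewrite -(FX i).
    apply: (@ge0_integral_distribution _ _ _ _ _ P (X i) (EFin \o F)).
      exact/measurable_EFinP.
    by move=> y; rewrite lee_fin.
  by rewrite -[in RHS](fineK finP) -!EFinM exprS; congr EFin; ring.
- exact: mprod.
- by move=> w; apply: mulr_ge0; apply: prodr_ge0 => j _ //; rewrite indicE.
- move=> D mD.
  have := IH (i |: J) (B D) us (mB _ mD) _.
  rewrite PB// EFinM fineK// -muleA [X in (_ * X)%E]muleC => <-.
    apply: eq_integral => w _; congr EFin.
    rewrite -mulrA; congr (_ * _); rewrite big_setU1//= /B eqxx mulrC; congr (_ * _).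
    by apply: eq_bigr => j jJ; rewrite ifN//; apply: contraNneq ilJ => <-.
  move=> j js; rewrite !inE negb_or (sJ j) ?inE ?js ?orbT// andbT.
  by apply: contraNneq ins => <-.
Qed.

(** Only an inequality, because [chi] has variance less than 1 when the window is empty or reaches
    beyond [n]. *)
Lemma std_normal_chi_mgf n (X : 'I_n -> {RV P >-> R}) (s : R) a b :
  iid_std_normal X ->
  (\int[P]_w (expR (s * chi (ext (X ^~ w)) a b))%:E <= (expR (s ^+ 2 / 2))%:E)%E.
Proof.
move=> [iX nX].
pose k := s / Num.sqrt (b - a)%:R.
pose J := [seq i : 'I_n <- enum 'I_n | (a <= i < b)%N].
have uJ : uniq J by rewrite filter_uniq// enum_uniq.
have mF : measurable_fun setT (fun x => expR (k * x)).
  by apply: measurableT_comp => //; apply: measurable_funM.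
have := @independent_integral_prod n X (fun x => expR (k * x)) (expR (k ^+ 2 / 2))
  iX mF (fun _ => expR_ge0 _) (expR_ge0 _) _ J finset.set0 (fun=> setT) uJ
  (fun=> measurableT).
move=> H; rewrite (_ : (\int[P]_w _)%E = (expR (k ^+ 2 / 2) ^+ size J)%:E).
  rewrite lee_fin -expRM_natl ler_expR.
  have [ab|ab] := leqP b a.
    rewrite (_ : J = [::]) ?mul0r ?divr_ge0 ?sqr_ge0//.
    by apply/eqP; rewrite -(negbK (_ == _)) -has_filter; apply/hasPn => i _ /=; lia.
  have sJ : (size J <= b - a)%N.
    rewrite -(size_map val) -(size_iota a (b - a)) uniq_leq_size//.
      by rewrite map_inj_uniq//; exact: val_inj.
    move=> l /mapP[i]; rewrite mem_filter => /andP[iab _] ->.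
    by rewrite mem_iota; move: iab => /=; lia.
  have ba0 : 0 < (b - a)%:R :> R by rewrite ltr0n subn_gt0.
  rewrite /k expr_div_n sqr_sqrtr ?ler0n//.
  rewrite [leRHS](_ : _ = (b - a)%:R * (s ^+ 2 / (b - a)%:R / 2)); last first.
    by field; rewrite gt_eqF.
  by rewrite ler_wpM2r ?ler_nat// !divr_ge0 ?sqr_ge0// ltW.
have {H} := H _ _.
rewrite (_ : [set` finset.set0] = set0); last by apply/seteqP; split=> i //=; rewrite inE.
rewrite bigcap_set0 probability_setT mule1 => <-.
- apply: eq_integral => w _; congr EFin; rewrite big_set0 mulr1.
  rewrite -expR_sum; congr expR; rewrite /chi wsum_ext mulrA mulrAC -/k mulr_sumr.
  rewrite /J big_filter big_enum_cond/=.
  by [].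
- move=> i; rewrite -(normal_prob_mgf k) -[RHS]mul1e.
  rewrite -(@integral_weighted _ _ _ _ _ P (normal_prob 0 1) (X i) (cst 1) 1)//.
  + by under [RHS]eq_integral do rewrite mul1r.
  + by move=> _ A mA; rewrite setTI; exact: measurable_preim_RV.
  + move=> A mA; under eq_integral do rewrite mul1r.
    rewrite integral_indic ?setIT ?mul1e ?nX//; last exact: measurable_preim_RV.
    exact: nX.
- by move=> i _; rewrite inE.
Qed.

End Independence.


(* Every bound on the noise is expressed with expsum, whose expectation is known
   from the moment generating function; no further moment is needed. *)
Section ExponentialSums.
Context {R : realType} d (Omega : measurableType d) (P : probability Omega R).

Definition expsum (t : R) (z : nat -> R) (s : seq (nat * nat)) : R :=
  \sum_(ab <- s) (expR (t * chi z ab.1 ab.2) + expR (- t * chi z ab.1 ab.2)).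

Lemma expsum_ge0 t z s : 0 <= expsum t z s.
Proof. by apply: sumr_ge0 => ab _; rewrite addr_ge0// expR_ge0. Qed.

Lemma measurable_chi n (X : 'I_n -> {RV P >-> R}) a b :
  measurable_fun setT (fun w => chi (ext (X ^~ w)) a b).
Proof.
rewrite (_ : (fun w => _) = fun w =>
  (\sum_(i < n) if (a <= i < b)%N then X i w else 0) / Num.sqrt (b - a)%:R).
  apply: measurable_funM => //.
  by apply: measurable_sum => i; case: (a <= i < b)%N.
by apply/funext => w; rewrite /chi wsum_ext big_mkcond.
Qed.

Lemma measurable_expsum n (X : 'I_n -> {RV P >-> R}) t s :
  measurable_fun setT (fun w => expsum t (ext (X ^~ w)) s).
Proof.
apply: measurable_sum => ab; apply: measurable_funD; apply: measurableT_comp => //;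
  by apply: measurable_funM => //; exact: measurable_chi.
Qed.

Lemma std_normal_expsum n (X : 'I_n -> {RV P >-> R}) t s : iid_std_normal X ->
  (\int[P]_w (expsum t (ext (X ^~ w)) s)%:E <=
   ((size s)%:R * (2 * expR (t ^+ 2 / 2)))%:E)%E.
Proof.
move=> iX; elim: s => [|ab s IH].
  rewrite mul0r; under eq_integral do rewrite /expsum big_nil.
  by rewrite integral0.
under eq_integral do rewrite /expsum big_cons EFinD EFinD -/(expsum t _ s).
have mexp u : measurable_fun setT
    (fun w => (expR (u * chi (ext (X ^~ w)) ab.1 ab.2))%:E).
  apply/measurable_EFinP; apply: measurableT_comp => //.
  by apply: measurable_funM => //; exact: measurable_chi.
rewrite !ge0_integralD//=.
- apply: (@le_trans _ _ ((expR (t ^+ 2 / 2))%:E + (expR (t ^+ 2 / 2))%:E +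
    ((size s)%:R * (2 * expR (t ^+ 2 / 2)))%:E)%E); last first.
    by rewrite -!EFinD lee_fin -natr1; lra.
  apply: leeD => //; apply: leeD; first exact: std_normal_chi_mgf.
  by rewrite -[in leRHS](sqrrN t); exact: std_normal_chi_mgf.
- by move=> w _; rewrite -EFinD lee_fin addr_ge0// expR_ge0.
- exact: emeasurable_funD.
- by move=> w _; rewrite lee_fin expsum_ge0.
- by apply/measurable_EFinP; exact: measurable_expsum.
Qed.

End ExponentialSums.

Section Law.
Context {R : realType} d (Omega : measurableType d) (P : probability Omega R).

Lemma iid_std_normal_comp n m (X : 'I_n -> {RV P >-> R}) (h : 'I_m -> 'I_n) :
  injective h -> iid_std_normal X -> iid_std_normal (fun i => X (h i)).
Proof.
move=> injh [iX nX]; split=> [J A mA|i A mA]; last exact: nX.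
pose A' i := if [pick k | h k == i] is Some k then A k else setT.
have A'E k : A' (h k) = A k.
  rewrite /A'; case: pickP => [l /eqP/injh -> //|/(_ k)]; by rewrite eqxx.
have mA' i : measurable (A' i) by rewrite /A'; case: pickP.
have := iX (h @: J)%SET A' mA'.
rewrite big_imset/=; last by move=> ? ? _ _; exact: injh.
under eq_bigr do rewrite A'E.
move=> <-; congr (P _); apply/seteqP; split=> w /= H.
  by move=> _ /= /imsetP[k kJ ->]; rewrite /preimage/= A'E; exact: H.
by move=> k /= kJ; have := H (h k) (imset_f _ kJ); rewrite /preimage/= A'E.
Qed.

Definition rvtuple n (X : 'I_n -> Omega -> R) (w : Omega) : n.-tuple R :=
  [tuple X i w | i < n].

Lemma measurable_rvtuple n (X : 'I_n -> {RV P >-> R}) :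
  measurable_fun setT (rvtuple X).
Proof.
apply/measurable_fun_tnthP => i; rewrite (_ : _ \o _ = X i)//.
by apply/funext => w /=; rewrite tnth_mktuple.
Qed.

(** Boxes form a pi-system generating the sigma-algebra of tuples, and independence determines the
    probability of each box. Applied to shifted families, this gives the translation invariance of
    the noise. *)
Lemma iid_std_normal_law n (X X' : 'I_n -> {RV P >-> R}) (B : set (n.-tuple R)) :
  iid_std_normal X -> iid_std_normal X' -> measurable B ->
  P (rvtuple X @^-1` B) = P (rvtuple X' @^-1` B).
Proof.
move=> [iX nX] [iX' nX'] mB.
pose box (A : 'I_n -> set R) : set (n.-tuple R) :=
  \bigcap_(i in [set: 'I_n]) ((@tnth n R) ^~ i @^-1` A i).
pose G := [set box A | A in [set A | forall i, measurable (A i)]].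
have mbox A : (forall i, measurable (A i)) -> measurable (box A).
  move=> mA; apply: fin_bigcap_measurable => [|i _]; first exact: finite_finset.
  by rewrite -[_ @^-1` _]setTI; apply: measurable_tnth.
have boxT : box (fun=> setT) = setT by apply/seteqP; split.
have P_box (Y : 'I_n -> {RV P >-> R}) A : independent_RVs Y ->
    (forall i (A : set R), measurable A -> distribution P (Y i) A = normal_prob 0 1 A) ->
    (forall i, measurable (A i)) ->
    P (rvtuple Y @^-1` box A) = (\prod_(i in [set: 'I_n]%SET) normal_prob 0 1 (A i))%E.
  move=> iY nY mA; rewrite (_ : _ @^-1` _ =
    \bigcap_(i in [set` [set: 'I_n]%SET]) (Y i @^-1` A i)).
    by rewrite iY//; apply: eq_bigr => i _; exact: nY.
  apply/seteqP; split=> w H i /= _.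
    by have := H i Logic.I; rewrite /= tnth_mktuple.
  by rewrite tnth_mktuple; apply: H => /=; rewrite inE.
have gen : measurable = <<s G >>.
  apply/seteqP; split.
    apply: smallest_sub; first exact: smallest_sigma_algebra.
    move=> C; rewrite -bigcup_seq => -[i _ [D mD <-]].
    apply: sub_sigma_algebra; exists (fun j => if j == i then D else setT).
      by move=> j; case: ifP.
    apply/seteqP; split=> t /=.
      by move/(_ i Logic.I); rewrite /= eqxx.
    by move=> [_ Dt] j _ /=; case: eqP => // ->.
  apply: smallest_sub; first exact: sigma_algebra_measurable.
  by move=> _ [A mA <-]; exact: mbox.
have GI : setI_closed G.
  move=> _ _ [A mA <-] [A' mA' <-]; exists (fun i => A i `&` A' i).
    by move=> i; exact: measurableI.
  apply/seteqP; split=> t /=.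
    by move=> H; split=> i _; have [] := H i Logic.I.
  by move=> [H H'] i _; split; [exact: H | exact: H'].
apply: (@measure_unique _ R _ G (fun=> setT) gen GI _ _
  (pushforward P (rvtuple X)) (pushforward P (rvtuple X'))) => //.
- by move=> _; exists (fun=> setT).
- by rewrite bigcup_const//; exists 0%N.
- exact: measurable_rvtuple.
- exact: measurable_rvtuple.
- by move=> ? ? _ [A mA <-]; exact: etrans (P_box X A iX nX mA) (esym (P_box X' A iX' nX' mA)).
- move=> ? _; apply: (@le_lt_trans _ _ (P setT)); last by rewrite probability_setT ltry.
  by rewrite /= /pushforward preimage_setT.
Qed.

End Law.


(** * The multiscale statistic on grid intervals *)

Section Multiscale.
Context {R : realType}.
Implicit Types (n a b i j : nat).

Lemma ler_grid n a b : (0 < n)%N -> (grid n a <= grid n b :> R) = (a <= b)%N.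
Proof. by move=> n0; rewrite /grid ler_pM2r ?ler_nat// invr_gt0 ltr0n. Qed.

Lemma ltr_grid n a b : (0 < n)%N -> (grid n a < grid n b :> R) = (a < b)%N.
Proof. by move=> n0; rewrite /grid ltr_pM2r ?ltr_nat// invr_gt0 ltr0n. Qed.

Lemma in_grid_itv n a b i : (0 < n)%N ->
  (grid n i \in `[(grid n a : R), grid n b[%classic) = (a <= i < b)%N.
Proof.
move=> n0; apply/idP/idP.
  by move/set_mem; rewrite /= in_itv/= ler_grid// ltr_grid.
by move=> iab; apply/mem_set; rewrite /= in_itv/= ler_grid// ltr_grid.
Qed.

Lemma npoints_grid n a b : (b <= n)%N ->
  npoints n `[(grid n a : R), grid n b[%classic = (b - a)%N.
Proof.
case: n => [|n] bn.
  by rewrite /npoints eq_card0 => [|[]//]; move: bn; case: b.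
rewrite /npoints -sum1_card.
under eq_bigl do rewrite inE in_grid_itv//.
rewrite -(big_mkord (fun i => (a <= i < b)%N) (fun=> 1%N)).
rewrite -[RHS]muln1 -sum_nat_const_nat.
rewrite [RHS](big_nat_widen a b n.+1)// (big_nat_widenl a 0)//.
by apply: eq_bigl => i /=; rewrite andbC.
Qed.

(** The closed window [i..j] of [multiscale] becomes the half-open range from [i] to [j.+1], so that
    its length is a plain difference. [m] is the number of sampling points of the interval. *)
Definition window_stat (sigma : R) (m : nat) (y : nat -> R) (c : R) (i j : nat) : R :=
  `|\sum_(i <= l < j) (y l - c)| / (sigma * Num.sqrt (j - i)%:R)
  - pen ((j - i)%:R / m%:R).

Lemma multiscale_le (sigma : R) n a b (Y : n.-tuple R) (c q : R) :
  (a < b <= n)%N ->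
  (multiscale sigma `[grid n a, grid n b[%classic Y c <= q <->
   forall i j, (a <= i)%N -> (i < j)%N -> (j <= b)%N ->
     window_stat sigma (b - a) (nth 0 Y) c i j <= q).
Proof.
move=> /andP[ab bn]; have n0 : (0 < n)%N by lia.
rewrite /multiscale npoints_grid//.
set S := [set x | _].
have stepE (i j : 'I_n) : (i <= j)%N ->
  `|\sum_(l < n | (i <= l <= j)%N) (tnth Y l - c)|
              / (sigma * Num.sqrt (j - i).+1%:R)
            - pen ((j - i).+1%:R / (b - a)%:R) =
  window_stat sigma (b - a) (nth 0 Y) c i j.+1.
  move=> ij; rewrite /window_stat subSn//; congr (`|_| / _ - _).
  rewrite [RHS](big_nat_widen i j.+1 n); last exact: ltn_ord.
  rewrite (big_nat_widenl i 0)// big_mkord.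
  by apply: eq_big => [l|l _]; rewrite ?(tnth_nth 0)// ltnS andbC.
have subE (i j : 'I_n) : (i <= j)%N ->
    (`[grid n i, grid n j]%classic `<=` `[(grid n a : R), grid n b[%classic) <->
    (a <= i)%N /\ (j < b)%N.
  move=> ij; split.
    move=> H; have := H (grid n i); have := H (grid n j).
    rewrite /= !in_itv/= !ler_grid// !ltr_grid// !leqnn ij/=.
    by move=> /(_ erefl)/andP[_ ->] /(_ erefl)/andP[-> _].
  move=> [ai jb] x /=; rewrite !in_itv/= => /andP[ix xj].
  rewrite (le_trans _ ix) ?ler_grid//=.
  by rewrite (le_lt_trans xj)// ltr_grid.
have SE x : S x <-> exists i j, [/\ (a <= i)%N, (i < j)%N, (j <= b)%N &
    x = window_stat sigma (b - a) (nth 0 Y) c i j].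
  split.
    move=> [i [j [ij /(subE _ _ ij)[ai jb] ->]]]; exists i, j.+1.
    by rewrite stepE.
  move=> [i [j [ai ij jb ->]]]; case: j ij jb => // j ij jb.
  have jn : (j < n)%N by lia.
  have i_n : (i < n)%N by lia.
  exists (Ordinal i_n), (Ordinal jn); split => //.
    by apply/subE.
  by rewrite stepE.
(* A real [sup] bounds its set only when the set has an upper bound; the sum of all absolute values
   is a crude one. *)
have ubS : has_ubound S.
  exists (\sum_(i < n.+1) \sum_(j < n.+1)
    `|window_stat sigma (b - a) (nth 0 Y) c i j|).
  move=> x /SE[i [j [ai ij jb ->]]].
  have i_n : (i < n.+1)%N by lia.
  have jn : (j < n.+1)%N by lia.
  rewrite (bigD1 (Ordinal i_n))//= (bigD1 (Ordinal jn))//= -addrA.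
  rewrite ler_wpDr ?ler_norm// addr_ge0// sumr_ge0// => ? _.
  by rewrite sumr_ge0.
have S0 : S !=set0.
  by exists (window_stat sigma (b - a) (nth 0 Y) c a b); apply/SE; exists a, b.
split.
  move=> Sq i j ai ij jb; apply: le_trans Sq; apply: ub_le_sup => //.
  by apply/SE; exists i, j.
move=> H; apply: ge_sup => // x /SE[i [j [ai ij jb ->]]]; exact: H.
Qed.

Lemma multiscale_gt (sigma : R) n a b (Y : n.-tuple R) (c q : R) :
  (a < b <= n)%N ->
  (q < multiscale sigma `[grid n a, grid n b[%classic Y c <->
   exists i j, [/\ (a <= i)%N, (i < j)%N, (j <= b)%N &
     q < window_stat sigma (b - a) (nth 0 Y) c i j]).
Proof.
move=> abn; split.
  apply: contraPP => H; apply/negP; rewrite -leNgt; apply/multiscale_le => //.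
  move=> i j ai ij jb; rewrite leNgt; apply/negP => qw; apply: H.
  by exists i, j.
move=> [i [j [ai ij jb qw]]]; rewrite ltNge; apply/negP => /(multiscale_le _ _ _ _ abn).
by move=> /(_ i j ai ij jb); rewrite leNgt qw.
Qed.

Lemma local_mean_grid n a b (Y : n.-tuple R) : (b <= n)%N -> (0 < n)%N ->
  local_mean `[grid n a, grid n b[%classic Y =
    (\sum_(a <= l < b) nth 0 Y l) / (b - a)%:R.
Proof.
move=> bn n0; rewrite /local_mean npoints_grid//; congr (_ / _).
under eq_bigl do rewrite in_grid_itv//.
rewrite [RHS](big_nat_widen a b n)// (big_nat_widenl a 0)// big_mkord.
by apply: eq_big => [l|l _]; rewrite ?(tnth_nth 0)// andbC.
Qed.

End Multiscale.


(** * Blocks of sampling points and exponential bounds *)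

Lemma sum_blocks (V : nmodType) (t : nat -> nat) (K : nat) (G : nat -> V) :
  (forall k, (k < K)%N -> (t k <= t k.+1)%N) ->
  \sum_(t 0%N <= l < t K) G l = \sum_(0 <= k < K) \sum_(t k <= l < t k.+1) G l.
Proof.
elim: K => [|K IH] tm; first by rewrite !big_geq.
have t0K : (t 0 <= t K)%N.
  elim: K {IH} tm => // K IH tm; rewrite (leq_trans (IH _)) ?tm//.
  by move=> k kK; apply: tm; rewrite ltnS ltnW.
rewrite big_nat_recr//= -IH; last by move=> k kK; apply: tm; exact: ltnW.
by rewrite (big_cat_nat t0K (tm _ _)).
Qed.

Lemma incr_homo_le (b : nat -> nat) N : (forall i, (i <= N)%N -> (b i < b i.+1)%N) ->
  forall i j, (i <= j)%N -> (j <= N.+1)%N -> (b i <= b j)%N.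
Proof.
move=> bi i; elim=> [|j IH]; first by rewrite leqn0 => /eqP ->.
rewrite leq_eqVlt => /orP[/eqP -> //|ij] jN.
rewrite (leq_trans (IH _ _))//; last by rewrite ltnW// bi.
exact: ltnW.
Qed.

Lemma locate_block (b : nat -> nat) N l :
  b 0%N = 0%N -> (l < b N.+1)%N ->
  exists2 j, (j <= N)%N & (b j <= l < b j.+1)%N.
Proof.
move=> b0; elim: N => [|N IH] lb; first by exists 0%N; rewrite ?b0.
have [lN|lN] := ltnP l (b N.+1).
  by have [j jN bj] := IH lN; exists j => //; exact: leqW.
by exists N.+1; rewrite ?lN.
Qed.

Section ExpBounds.
Context {R : realType}.
Implicit Types (x y t : R).

Definition c6 : R := 6`!%:R.

Lemma c6_gt0 : 0 < c6. Proof. by rewrite /c6 ltr0n fact_gt0. Qed.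

Lemma exp6_le (x : R) : x ^+ 6 <= c6 * (expR x + expR (- x)).
Proof.
have pos (w : R) : 0 <= w -> w ^+ 6 <= c6 * expR w.
  (* Index 5 yields the Taylor term of degree 6. *)
  move=> w0; have := expR_ge1Dxn 5 w0; rewrite -/c6 => H.
  rewrite mulrC -ler_pdivrMr ?c6_gt0// (le_trans _ H)//.
  by rewrite lerDr.
have [x0|x0] := leP 0 x.
  by rewrite mulrDr ler_wpDr ?pos// mulr_ge0 ?expR_ge0// ltW// c6_gt0.
rewrite (_ : x ^+ 6 = (- x) ^+ 6); last by ring.
rewrite mulrDr ler_wpDl ?pos//; first by rewrite mulr_ge0 ?expR_ge0// ltW// c6_gt0.
by rewrite oppr_ge0 ltW.
Qed.

(** If [w ^+ 2] exceeds [x], then [w ^+ 2 * x ^+ 2 <= w ^+ 6], and the sixth power is dominated by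
    exponentials. *)
Lemma sqr_le_expR (w x : R) : 0 < x ->
  w ^+ 2 <= x + c6 / x ^+ 2 * (expR w + expR (- w)).
Proof.
move=> x0; have [wx|xw] := leP (w ^+ 2) x.
  rewrite (le_trans wx)// lerDl mulr_ge0 ?addr_ge0 ?expR_ge0//.
  by rewrite divr_ge0 ?sqr_ge0// ltW// c6_gt0.
apply: ler_wpDl; first exact: ltW.
rewrite mulrAC ler_pdivlMr ?exprn_gt0//; apply: le_trans (exp6_le w).
rewrite (_ : w ^+ 6 = w ^+ 2 * (w ^+ 2) ^+ 2); last by ring.
rewrite ler_wpM2l ?sqr_ge0// ler_sqr ?nnegrE ?sqr_ge0//; exact: ltW.
Qed.

Lemma le_expsum t (z : nat -> R) (a b : nat) s : (a, b) \in s ->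
  expR (t * chi z a b) + expR (- t * chi z a b) <= expsum t z s.
Proof.
move=> abs; rewrite /expsum (big_rem (a, b))//= lerDl.
by rewrite sumr_ge0// => p _; rewrite addr_ge0// expR_ge0.
Qed.

Lemma le_expsum1 (z : nat -> R) (a b : nat) s : (a, b) \in s ->
  expR (chi z a b) + expR (- chi z a b) <= expsum 1 z s.
Proof. by move=> abs; have := le_expsum 1 z abs; rewrite mul1r mulN1r. Qed.

End ExpBounds.

(** * Localisation of the change-points *)

Section Core.
Context {R : realType}.
Variables (n K r : nat) (t : nat -> nat) (c m y z : nat -> R).
Variables (sigma epsilon L T : R) (q : nat -> R).
Hypotheses (t_first : t 0%N = 0%N) (t_last : t K.+1 = n) (r_gt0 : (0 < r)%N).
Hypothesis t_gap : forall k, (k <= K)%N -> (t k + 4 * r <= t k.+1)%N.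
Hypotheses (sigma0 : 0 < sigma) (epsL : 0 < epsilon < L).
Hypothesis jumpP : forall k, (k < K)%N -> epsilon <= `|c k.+1 - c k| <= L.
Hypothesis mE : forall k l, (k <= K)%N -> (t k <= l < t k.+1)%N -> m l = c k.
Hypothesis yE : forall l, (l < n)%N -> y l = m l + sigma * z l.
Hypothesis zT : forall a b, (a < b)%N -> (b <= n)%N -> `|chi z a b| <= T.
Hypothesis penT : forall w k, (0 < w)%N -> (w <= k)%N -> (k <= n)%N ->
  pen (w%:R / k%:R : R) <= T.
Hypothesis qT : forall k, (0 < k)%N -> (k <= n)%N -> q k <= 2 * T.
Hypothesis rT : 8 * sigma * T < epsilon * Num.sqrt r%:R.

Definition feasible (a b : nat) (v : R) := forall i j,
  (a <= i)%N -> (i < j)%N -> (j <= b)%N -> window_stat sigma (b - a) y v i j <= q (b - a).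

Let t_le i j : (i <= j)%N -> (j <= K.+1)%N -> (t i <= t j)%N.
Proof. by apply: incr_homo_le => k kK; have := t_gap kK; lia. Qed.

Lemma feasible_level a b v k i : (a < b)%N -> (b <= n)%N -> (k <= K)%N ->
  feasible a b v -> (a <= i)%N -> (i + r <= b)%N ->
  (t k <= i)%N -> (i + r <= t k.+1)%N -> `|v - c k| < epsilon / 2.
Proof.
move=> ab bn kK fv ai irb ti irt.
have := fv i (i + r)%N ai _ irb; rewrite -{1}[i]addn0 ltn_add2l => /(_ r_gt0).
rewrite /window_stat addKn.
have tn : (t k.+1 <= n)%N by rewrite -t_last t_le.
rewrite (eq_big_nat _ _ (F2 := fun l => (c k - v) + sigma * z l)); last first.
  move=> l /andP[il lir]; rewrite yE ?(mE kK)//; first by ring.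
  - by rewrite (leq_trans ti)//; lia.
  - by lia.
rewrite big_split/= sumr_const_nat addKn -mulr_sumr -/(wsum z i (i + r)).
have s0 : 0 < Num.sqrt r%:R :> R by rewrite sqrtr_gt0 ltr0n.
have sE : Num.sqrt r%:R ^+ 2 = r%:R :> R by rewrite sqr_sqrtr// ler0n.
have -> : wsum z i (i + r) = chi z i (i + r) * Num.sqrt r%:R.
  by rewrite /chi addKn divfK// gt_eqF.
have irn : (i + r <= n)%N by lia.
have ii : (i < i + r)%N by lia.
have := zT ii irn; have ba0 : (0 < b - a)%N by lia.
have ban : (b - a <= n)%N by lia.
have rba : (r <= b - a)%N by lia.
have := penT r_gt0 rba ban; have := qT ba0 ban; have rT' := rT.
set x := chi _ _ _; set pp := pen _; set s := Num.sqrt _ in s0 sE rT' *.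
rewrite -(mulr_natl (c k - v)) -sE => q2 p1 xT W.
have {}W : `|s ^+ 2 * (c k - v) + sigma * (x * s)| <= 3 * T * (sigma * s).
  by rewrite -ler_pdivrMr ?mulr_gt0//; lra.
have W2 : s ^+ 2 * `|v - c k| <= 3 * T * (sigma * s) + sigma * (T * s).
  have -> : s ^+ 2 * `|v - c k| = `|(s ^+ 2 * (c k - v) + sigma * (x * s)) - sigma * (x * s)|.
    by rewrite addrK normrM ger0_norm ?sqr_ge0// distrC.
  rewrite (le_trans (ler_normB _ _))// lerD//.
  rewrite normrM (gtr0_norm sigma0) normrM (gtr0_norm s0).
  by rewrite ler_wpM2l ?ler_wpM2r ?(ltW sigma0) ?(ltW s0).
have {}W2 : s * `|v - c k| <= 4 * sigma * T.
  rewrite -(ler_pM2l s0) mulrA -expr2 (le_trans W2)//.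
  by rewrite le_eqVlt; apply/orP; left; apply/eqP; ring.
have : s * `|v - c k| < s * (epsilon / 2) by lra.
by rewrite ltr_pM2l.
Qed.

Variables (Kh : nat) (b : nat -> nat) (ch fh : nat -> R).
Hypotheses (b_first : b 0%N = 0%N) (b_last : b Kh.+1 = n).
Hypothesis b_lt : forall i, (i <= Kh)%N -> (b i < b i.+1)%N.
Hypothesis b_feas : forall i, (i <= Kh)%N -> feasible (b i) (b i.+1) (ch i).
Hypothesis KhK : (Kh <= K)%N.
Hypothesis fhE : forall i l, (i <= Kh)%N -> (b i <= l < b i.+1)%N -> fh l = ch i.

Let b_le i j : (i <= j)%N -> (j <= Kh.+1)%N -> (b i <= b j)%N.
Proof. exact: incr_homo_le. Qed.

Let near j k := (t k < b j + r)%N && (b j < t k + r)%N.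

(** The end points 0 and [n] count as change-points and are matched by themselves, which lets the
    index counts below start from either end. *)
Lemma change_detected k : (k <= K.+1)%N ->
  exists2 j, (j <= Kh.+1)%N & near j k.
Proof.
move=> kK; have [->|k0] := posnP k.
  by exists 0%N => //; rewrite /near b_first t_first; lia.
move: kK; rewrite leq_eqVlt => /orP[/eqP ->|kK].
  by exists Kh.+1 => //; rewrite /near b_last t_last; lia.
case: k k0 kK => // k _; rewrite ltnS => kK.
have tkn : (t k.+1 < b Kh.+1)%N.
  by rewrite b_last -t_last (leq_trans _ (t_le (_ : (k.+2 <= K.+1)%N) _))//; have := t_gap kK; lia.
have [j jK /andP[bj tj]] := locate_block b_first tkn.
have [h|h] := ltnP (t k.+1) (b j + r); first by exists j; [lia|rewrite /near; lia].
have [h'|h'] := ltnP (b j.+1) (t k.+1 + r); first by exists j.+1; [lia|rewrite /near; lia].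
have bjn : (b j.+1 <= n)%N by rewrite -b_last b_le.
have g1 := t_gap kK; have g2 := t_gap (ltnW kK).
(* A single fitted level within [epsilon / 2] of two consecutive true levels contradicts the minimal
   jump. *)
have e1 : `|ch j - c k| < epsilon / 2.
  by apply: (@feasible_level (b j) (b j.+1) _ k (t k.+1 - r)) => //; by [exact: b_feas|lia].
have e2 : `|ch j - c k.+1| < epsilon / 2.
  by apply: (@feasible_level (b j) (b j.+1) _ k.+1 (t k.+1)) => //; by [exact: b_feas|lia].
have /andP[ej _] := jumpP kK.
have : `|c k.+1 - c k| <= `|ch j - c k| + `|ch j - c k.+1|.
  by rewrite (_ : c k.+1 - c k = (ch j - c k) - (ch j - c k.+1)) ?ler_normB//; ring.
lra.
Qed.

Let near_lt j j' k : (k <= K)%N -> (j <= Kh.+1)%N -> near j k -> near j' k.+1 -> (j < j')%N.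
Proof.
move=> kK jK /andP[_ h1] /andP[h2 _]; rewrite ltnNge; apply/negP => jj.
by have := b_le jj jK; have := t_gap kK; lia.
Qed.

(** Matches of consecutive true change-points have strictly increasing indices, since these
    change-points are at least [4 * r] apart and each match is within [r]. Counting up from 0 bounds
    the index from below; [near_le] counts down from the right end. *)
Let near_ge k : (k <= K.+1)%N -> forall j, (j <= Kh.+1)%N -> near j k -> (k <= j)%N.
Proof.
elim: k => // k IH kK j jK jk; have [j' j'K j'k] := change_detected (ltnW kK).
have := near_lt kK j'K j'k jk; have := IH (ltnW kK) _ j'K j'k; lia.
Qed.

Let near_le i k : (k + i = K.+1)%N -> forall j, (j <= Kh.+1)%N -> near j k ->
  (j + i <= Kh.+1)%N.
Proof.
elim: i k => [|i IH] k kiK j jK jk; first by rewrite addn0.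
have kK : (k.+1 <= K.+1)%N by lia.
have [j' j'K j'k] := change_detected kK.
have := near_lt kK jK jk j'k; have := IH k.+1 _ _ j'K j'k; lia.
Qed.

(** Index 0 matches itself, so counting from the right end gives [K.+1 <= Kh.+1]; the reverse is
    [KhK]. *)
Lemma nchange_correct : Kh = K.
Proof.
have n0 : near 0 0 by rewrite /near b_first t_first; lia.
have := near_le (add0n K.+1) (leq0n _) n0; lia.
Qed.

(** The two counts pinch the index of any match of [k] to [k] itself. *)
Lemma change_close k : (k <= K.+1)%N -> (t k < b k + r)%N /\ (b k < t k + r)%N.
Proof.
move=> kK; have [j jK jk] := change_detected kK.
have kiK : (k + (K.+1 - k) = K.+1)%N by lia.
have := near_ge kK jK jk; have := near_le kiK jK jk.
rewrite nchange_correct => h1 h2; have jk' : j = k by lia.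
by move: jk; rewrite jk' => /andP[].
Qed.

Lemma level_close k : (k <= K)%N -> `|ch k - c k| < epsilon / 2.
Proof.
move=> kK; have kKh : (k <= Kh)%N by rewrite nchange_correct.
have [h1 h2] := change_close (leqW kK).
have [h3 h4] := change_close (kK : (k.+1 <= K.+1)%N).
have g := t_gap kK; have bjn : (b k.+1 <= n)%N by rewrite -b_last b_le.
(* The witness is the start of the overlap of the [k]-th true and fitted segments, which has at
   least [2 * r] points. *)
apply: (@feasible_level (b k) (b k.+1) _ k (maxn (b k) (t k))) => //;
  by [exact: b_lt|exact: b_feas|lia].
Qed.

(** The [k]-th true segment is cut at [u k] and [v k]: left of [u k] the fit still has its preceding
    level, from [v k] on already its next one, and in between the matching one. *)
Let u k := maxn (t k) (b k).
Let v k := minn (t k.+1) (b k.+1).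

Lemma fit_left k l : (k <= K)%N -> (t k <= l < u k)%N ->
  (0 < k)%N /\ fh l = ch k.-1.
Proof.
move=> kK /andP[tl lu]; have k0 : (0 < k)%N.
  by case: k kK tl lu => // _; rewrite /u t_first b_first; lia.
split=> //; have h : (k.-1 <= K)%N by lia.
have [h1 h2] := change_close (leqW h); have := t_gap h; rewrite prednK// => g.
by apply: fhE; rewrite ?nchange_correct// prednK//; rewrite /u in lu; lia.
Qed.

Lemma fit_mid k l : (k <= K)%N -> (u k <= l < v k)%N -> fh l = ch k.
Proof. by move=> kK lu; apply: fhE; rewrite ?nchange_correct// /u /v in lu *; lia. Qed.

Lemma fit_right k l : (k <= K)%N -> (v k <= l < t k.+1)%N ->
  (k < K)%N /\ fh l = ch k.+1.
Proof.
move=> kK /andP[vl lt]; have kK' : (k < K)%N.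
  move: kK; rewrite leq_eqVlt => /orP[/eqP kK|//]; move: vl lt.
  by rewrite /v kK t_last -{1}nchange_correct b_last; lia.
split=> //; have [h1 h2] := change_close (kK' : (k.+2 <= K.+1)%N).
have := t_gap kK' => g; apply: fhE; rewrite ?nchange_correct//; rewrite /v in vl; lia.
Qed.

Let uv k : (k <= K)%N -> [/\ (t k <= u k < t k + r)%N, (u k <= v k)%N &
  (t k.+1 < v k + r)%N && (v k <= t k.+1)%N].
Proof.
move=> kK; have [h1 h2] := change_close (leqW kK).
have [h3 h4] := change_close (kK : (k.+1 <= K.+1)%N).
by have g := t_gap kK; rewrite /u /v; split; lia.
Qed.

(** A fitted level is within [epsilon / 2] of the true level of the same index, and the latter is at
    most one jump away from the level at [l]. *)
Lemma fit_error_le l : (l < n)%N -> `|fh l - m l| <= 2 * L.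
Proof.
move=> ln; have [e0 eL] := andP epsL.
have tl : (l < t K.+1)%N by rewrite t_last.
have [k kK /andP[tl' lt]] := locate_block t_first tl.
rewrite (@mE k)// ?tl' ?lt//.
have near_fit x k' : (k' <= K)%N -> `|x - c k| <= L -> x = c k' ->
    `|ch k' - c k| <= 2 * L.
  move=> k'K + xE; rewrite xE => xL; have := level_close k'K => e.
  have : `|ch k' - c k| <= `|ch k' - c k'| + `|c k' - c k|.
    by rewrite (_ : ch k' - c k = (ch k' - c k') + (c k' - c k)) ?ler_normD//; ring.
  lra.
have [lu|lu] := ltnP l (u k).
  have [k0 ->] := fit_left kK (introT andP (conj tl' lu)).
  apply: (near_fit (c k.-1)) => //; first by lia.
  have k1 : (k.-1 < K)%N by lia.
  by have := jumpP k1; rewrite prednK// distrC => /andP[].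
have [lv|lv] := ltnP l (v k).
  rewrite (fit_mid kK) ?lu//; apply: (near_fit (c k)) => //.
  by rewrite subrr normr0; lra.
have [k1 ->] := fit_right kK (introT andP (conj lv lt)).
by apply: (near_fit (c k.+1)) => //; have /andP[] := jumpP k1.
Qed.

(* [0 <= (s x - 2 sigma chi)^2], with s the square root of the length. *)
Lemma cross_term_le (a a' : nat) (x : R) (F : nat -> R) : (a <= a')%N ->
  (forall l, (a <= l < a')%N -> F l = x) ->
  2 * sigma * \sum_(a <= l < a') z l * F l <=
  (\sum_(a <= l < a') F l ^+ 2) / 2 + 2 * sigma ^+ 2 * chi z a a' ^+ 2.
Proof.
move=> aa Fx.
rewrite (eq_big_nat _ _ (F2 := fun l => z l * x)); last by move=> l /Fx ->.
rewrite [in leRHS](eq_big_nat _ _ (F2 := fun=> x ^+ 2)); last by move=> l /Fx ->.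
rewrite -mulr_suml -/(wsum z a a') sumr_const_nat -(mulr_natl (x ^+ 2)).
have [ba|ab] := leqP a' a.
  rewrite /wsum big_geq// mul0r mulr0 addr_ge0//.
    by rewrite divr_ge0// mulr_ge0 ?ler0n ?sqr_ge0.
  by apply: mulr_ge0; rewrite ?sqr_ge0// mulr_ge0 ?sqr_ge0.
have l0 : 0 < (a' - a)%:R :> R by rewrite ltr0n subn_gt0.
have s0 : 0 < Num.sqrt (a' - a)%:R :> R by rewrite sqrtr_gt0.
rewrite -[X in X * x ^+ 2](sqr_sqrtr (ltW l0)).
have -> : wsum z a a' = chi z a a' * Num.sqrt (a' - a)%:R.
  by rewrite /chi divfK// gt_eqF.
move: (Num.sqrt _) (chi _ _ _) => s w.
by have := sqr_ge0 (s * x - 2 * sigma * w); rewrite -subr_ge0; lra.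
Qed.

(** Half of the squared error returned by [cross_term_le] is absorbed on the left, which doubles the
    factor [2 * sigma ^+ 2]. *)
Lemma fit_error_chi :
  \sum_(0 <= l < n) (y l - fh l) ^+ 2 <= \sum_(0 <= l < n) (y l - m l) ^+ 2 ->
  \sum_(0 <= l < n) (fh l - m l) ^+ 2 <= 4 * sigma ^+ 2 *
    \sum_(0 <= k < K.+1) (chi z (t k) (u k) ^+ 2 + chi z (u k) (v k) ^+ 2
                          + chi z (v k) (t k.+1) ^+ 2).
Proof.
move=> rss; set F := fun l => fh l - m l.
(* Basic inequality of least squares: with [y = m + sigma * z] the squares of the noise cancel. *)
have basic : \sum_(0 <= l < n) F l ^+ 2 <= 2 * sigma * \sum_(0 <= l < n) z l * F l.
  move: rss; rewrite -subr_ge0 -sumrB => rss; rewrite -subr_ge0 mulr_sumr -sumrB.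
  rewrite (eq_big_nat _ _ (F2 := fun l => (y l - m l) ^+ 2 - (y l - fh l) ^+ 2))//.
  by move=> l /andP[_ ln]; rewrite yE// /F; ring.
have tmono k : (k < K.+1)%N -> (t k <= t k.+1)%N by move=> kK; exact: t_le.
have block G : \sum_(0 <= l < n) (G l : R) =
    \sum_(0 <= k < K.+1) (\sum_(t k <= l < u k) G l + \sum_(u k <= l < v k) G l
       + \sum_(v k <= l < t k.+1) G l).
  rewrite -t_last -{1}t_first sum_blocks//; apply: eq_big_nat => k /andP[_ kK].
  have [/andP[h1 _] h2 /andP[_ h3]] := uv kK.
  rewrite (big_cat_nat (n := v k))//=; last by lia.
  by rewrite (big_cat_nat h1 h2).
have cross : 2 * sigma * \sum_(0 <= l < n) z l * F l <=
    (\sum_(0 <= l < n) F l ^+ 2) / 2 + 2 * sigma ^+ 2 *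
    \sum_(0 <= k < K.+1) (chi z (t k) (u k) ^+ 2 + chi z (u k) (v k) ^+ 2
                          + chi z (v k) (t k.+1) ^+ 2).
  rewrite !block mulr_suml !mulr_sumr -big_split/= !big_nat.
  apply: ler_sum => k /andP[_ kK]; have [/andP[h1 _] h2 /andP[_ h3]] := uv kK.
  have hm l : (t k <= l < t k.+1)%N -> m l = c k by exact: mE.
  have c1 : 2 * sigma * \sum_(t k <= l < u k) z l * F l <=
      (\sum_(t k <= l < u k) F l ^+ 2) / 2 + 2 * sigma ^+ 2 * chi z (t k) (u k) ^+ 2.
    apply: (cross_term_le (x := ch k.-1 - c k)) => // l lI.
    by rewrite /F (fit_left kK lI).2 hm//; lia.
  have c2 : 2 * sigma * \sum_(u k <= l < v k) z l * F l <=
      (\sum_(u k <= l < v k) F l ^+ 2) / 2 + 2 * sigma ^+ 2 * chi z (u k) (v k) ^+ 2.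
    apply: (cross_term_le (x := ch k - c k)) => // l lI.
    by rewrite /F (fit_mid kK lI) hm//; lia.
  have c3 : 2 * sigma * \sum_(v k <= l < t k.+1) z l * F l <=
      (\sum_(v k <= l < t k.+1) F l ^+ 2) / 2
        + 2 * sigma ^+ 2 * chi z (v k) (t k.+1) ^+ 2.
    apply: (cross_term_le (x := ch k.+1 - c k)) => // l lI.
    by rewrite /F (fit_right kK lI).2 hm//; lia.
  lra.
lra.
Qed.

(* The pieces of the common refinement inside the k-th true segment, for all
   possible positions of the matching estimated change-points. *)
Definition near_windows (k : nat) : seq (nat * nat) :=
  [seq ((t k + i)%N, (t k.+1 - j)%N) | i <- iota 0 r, j <- iota 0 r] ++
  [seq (t k, (t k + i)%N) | i <- iota 0 r] ++
  [seq ((t k.+1 - j)%N, t k.+1) | j <- iota 0 r].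

Lemma size_near_windows k : size (near_windows k) = (r * r + (r + r))%N.
Proof. by rewrite !size_cat size_allpairs !size_map size_iota. Qed.

Lemma fit_error_expsum (x : R) : 0 < x ->
  \sum_(0 <= l < n) (y l - fh l) ^+ 2 <= \sum_(0 <= l < n) (y l - m l) ^+ 2 ->
  \sum_(0 <= l < n) (fh l - m l) ^+ 2 <= 4 * sigma ^+ 2 *
    \sum_(0 <= k < K.+1) (3 * x + 3 * c6 / x ^+ 2 * expsum 1 z (near_windows k)).
Proof.
move=> x0 /fit_error_chi/le_trans; apply; rewrite ler_wpM2l//.
  by rewrite mulr_ge0// sqr_ge0.
rewrite !big_nat; apply: ler_sum => k /andP[_ kK].
have [/andP[h1 h1'] h2 /andP[h3 h3']] := uv kK.
have w1 : (t k, u k) \in near_windows k.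
  rewrite !mem_cat; apply/orP; right; apply/orP; left; apply/mapP.
  by exists (u k - t k)%N; [rewrite mem_iota; lia | rewrite subnKC].
have w2 : (u k, v k) \in near_windows k.
  rewrite mem_cat; apply/orP; left; apply/allpairsP.
  exists ((u k - t k)%N, (t k.+1 - v k)%N); split=> /=; rewrite ?mem_iota; try lia.
  by rewrite subnKC// subKn.
have w3 : (v k, t k.+1) \in near_windows k.
  rewrite !mem_cat; apply/orP; right; apply/orP; right; apply/mapP.
  by exists (t k.+1 - v k)%N; [rewrite mem_iota; lia | rewrite subKn].
have bound a a' : (a, a') \in near_windows k ->
    chi z a a' ^+ 2 <= x + c6 / x ^+ 2 * expsum 1 z (near_windows k).
  move=> aw; apply: le_trans (sqr_le_expR _ x0) _; rewrite lerD2l ler_wpM2l//.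
    by rewrite divr_ge0 ?sqr_ge0// ltW// c6_gt0.
  exact: le_expsum1.
have := bound _ _ w1; have := bound _ _ w2; have := bound _ _ w3.
have -> : 3 * c6 / x ^+ 2 * expsum 1 z (near_windows k) =
  3 * (c6 / x ^+ 2 * expsum 1 z (near_windows k)) by rewrite -!mulrA.
move: (c6 / x ^+ 2 * _) (chi _ _ _ ^+ 2) (chi _ _ _ ^+ 2) (chi _ _ _ ^+ 2).
by move=> e w3' w2' w1'; lra.
Qed.

End Core.

(** * Step functions seen on the sampling grid *)

Lemma sum_indic_itv (R : realType) (a c : nat -> R) N j x :
  (forall i, (i <= N)%N -> a i <= a i.+1) -> (j <= N)%N -> a j <= x < a j.+1 ->
  \sum_(i < N.+1) c i * \1_(`[a i, a i.+1[) x = c j.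
Proof.
move=> ai jN /andP[jx xj].
have a_le i k : (i <= k)%N -> (k <= N.+1)%N -> a i <= a k.
  elim: k => [|k IH]; first by rewrite leqn0 => /eqP ->.
  rewrite leq_eqVlt => /orP[/eqP -> //|ik] kN.
  by apply: le_trans (IH ik (ltnW kN)) _; exact: ai.
rewrite (bigD1 (Ordinal (jN : (j < N.+1)%N)))//= big1 ?addr0.
  by rewrite indicE mem_set ?mulr1//= in_itv/= jx.
move=> i; rewrite -val_eqE/= => ij.
rewrite indicE memNset ?mulr0//= in_itv/= => /andP[ix xi].
have [ij'|ji|/eqP] := ltngtP i j; last by rewrite (negbTE ij).
- by have := a_le _ _ ij' (leqW jN); rewrite leNgt (le_lt_trans jx xi).
- by have := a_le _ _ ji (leqW (leq_ord i)); rewrite leNgt (le_lt_trans ix xj).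
Qed.

Section Discretize.
Context {R : realType}.
Variable mu : stepfun R.
Local Notation K := (nchange mu).

Lemma tau_homo i j : (i < j)%N -> (j <= K.+1)%N -> tau mu i < tau mu j.
Proof.
elim: j => // j IH; rewrite ltnS leq_eqVlt => /orP[/eqP ->|ij] jK.
  exact: tau_lt.
by apply: lt_trans (IH ij (ltnW jK)) _; exact: tau_lt.
Qed.

Lemma tau_homo_le i j : (i <= j)%N -> (j <= K.+1)%N -> tau mu i <= tau mu j.
Proof.
by rewrite leq_eqVlt => /orP[/eqP -> //|ij jK]; apply/ltW/tau_homo.
Qed.

Lemma tau_ge0 k : (k <= K.+1)%N -> 0 <= tau mu k.
Proof. by move=> kK; rewrite -(tau_first mu) tau_homo_le. Qed.

Lemma tau_locate x : 0 <= x < 1 ->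
  exists2 k, (k <= K)%N & tau mu k <= x < tau mu k.+1.
Proof.
move=> /andP[x0]; rewrite -(tau_last mu).
elim: K => [|N IH] xN; first by exists 0%N; rewrite // tau_first x0.
have [xN'|xN'] := ltP x (tau mu N.+1).
  by have [j jN bj] := IH xN'; exists j => //; exact: leqW.
by exists N.+1; rewrite ?xN'.
Qed.

Lemma stepvalE k x : (k <= K)%N -> tau mu k <= x < tau mu k.+1 ->
  stepval mu x = level mu k.
Proof. by apply: sum_indic_itv => i iK; rewrite ltW// tau_lt. Qed.

Variables (n : nat).
Hypothesis n_gt0 : (0 < n)%N.

Let n0 : 0 < n%:R :> R. Proof. by rewrite ltr0n. Qed.

(* The first sampling point at or after the k-th change-point. *)
Definition tgrid k : nat := `|Num.ceil (n%:R * tau mu k)|%N.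

Lemma tgridE k : (k <= K.+1)%N -> (tgrid k)%:Z = Num.ceil (n%:R * tau mu k).
Proof.
move=> kK; rewrite /tgrid gez0_abs// ceil_ge0.
by apply: lt_le_trans (_ : 0 <= _); rewrite ?ltrN10// mulr_ge0// tau_ge0.
Qed.

Lemma tgrid_gt l k : (k <= K.+1)%N -> (l < tgrid k)%N = (grid n l < tau mu k).
Proof.
move=> kK; rewrite -ltz_nat tgridE// ceil_gt_int /grid ltr_pdivrMr// mulrC.
by rewrite -pmulrn.
Qed.

Lemma tgrid_le l k : (k <= K.+1)%N -> (tgrid k <= l)%N = (tau mu k <= grid n l).
Proof. by move=> kK; rewrite leqNgt tgrid_gt// -leNgt. Qed.

Lemma tgrid_first : tgrid 0 = 0%N.
Proof. by rewrite /tgrid tau_first mulr0 ceil0. Qed.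

Lemma tgrid_last : tgrid K.+1 = n.
Proof. by rewrite /tgrid tau_last mulr1 pmulrn intrKceil. Qed.

(** Rounding a change-point up to the grid may cost one sampling point, hence [g.+1]. *)
Lemma tgrid_gap (nu : R) (g k : nat) : (k <= K)%N -> nu <= min_gap mu ->
  g.+1%:R <= n%:R * nu -> (tgrid k + g <= tgrid k.+1)%N.
Proof.
move=> kK nug gn.
have nuk : nu <= tau mu k.+1 - tau mu k.
  apply: le_trans nug _; rewrite /min_gap.
  apply: (@le_trans _ _ (gap mu k)).
    by apply: (@bigmin_inf_seq _ _ _ _ _ k) => //; rewrite mem_index_iota.
  by rewrite /gap gtr0_norm// subr_gt0 tau_lt.
have [h1 h2] : (tgrid k)%:R - 1 < n%:R * tau mu k :> R /\
    n%:R * tau mu k.+1 <= (tgrid k.+1)%:R.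
  split.
    have := ceilB1_lt (n%:R * tau mu k); rewrite -tgridE; last exact: leqW.
    by rewrite intrB.
  by have := ceil_ge (n%:R * tau mu k.+1); rewrite -tgridE.
have h3 : n%:R * nu <= n%:R * (tau mu k.+1 - tau mu k) by rewrite ler_pM2l.
rewrite -(ler_nat R) natrD.
have : (tgrid k)%:R + g%:R < (tgrid k.+1)%:R :> R.
  by move: gn; rewrite -natr1; lra.
exact: ltW.
Qed.

Lemma stepval_grid k l : (k <= K)%N -> (tgrid k <= l < tgrid k.+1)%N ->
  stepval mu (grid n l) = level mu k.
Proof.
move=> kK; rewrite tgrid_le ?leqW// tgrid_gt// => lk; exact: stepvalE.
Qed.

(** Change-points are at least two cells apart, so at most one jump separates [x] from the grid
    point on its left; the sum tests whether a change-point lies in this cell. Its total over all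
    cells is at most the number of change-points, which makes the discretisation error small. *)
Lemma stepval_cell (nu epsilon L x : R) (l : nat) : (l < n)%N -> 0 <= L ->
  stepclass nu epsilon L mu -> 2 <= n%:R * nu ->
  grid n l <= x < grid n l.+1 ->
  `|stepval mu x - stepval mu (grid n l)| ^+ 2 <=
    L ^+ 2 * \sum_(1 <= k < K.+1) (tgrid k == l.+1)%:R /\
  `|stepval mu x - stepval mu (grid n l)| <= L.
Proof.
move=> ln L0 [nug jmp] nn /andP[lx xl].
have x01 : 0 <= x < 1.
  rewrite (le_trans _ lx) ?divr_ge0//= (lt_le_trans xl)//.
  by rewrite /grid ler_pdivrMr// mul1r ler_nat.
have l01 : 0 <= (grid n l : R) < 1.
  by rewrite divr_ge0//= ltr_pdivrMr// mul1r ltr_nat.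
have [k kK /andP[kl lk]] := tau_locate l01.
rewrite (stepvalE kK (introT andP (conj kl lk))).
have [xk|kx] := ltP x (tau mu k.+1).
  rewrite (stepvalE kK); last by rewrite xk (le_trans kl).
  rewrite subrr normr0; split=> //; rewrite expr0n mulr_ge0 ?sqr_ge0//.
  by rewrite sumr_ge0.
have kK' : (k < K)%N.
  rewrite ltn_neqAle kK andbT; apply/eqP => kE.
  by move: kx; rewrite kE tau_last leNgt; case/andP: x01 => _ ->.
have tk1 : tgrid k.+1 = l.+1.
  apply/eqP; rewrite eqn_leq tgrid_gt ?lk ?andbT// tgrid_le//.
  exact: le_trans kx (ltW xl).
have tk2 : (l.+2 <= tgrid k.+2)%N.
  by have := @tgrid_gap nu 1 k.+1 kK' nug nn; rewrite tk1 addn1.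
have xk2 : tau mu k.+1 <= x < tau mu k.+2.
  rewrite kx/= (lt_le_trans xl)// ltW// -tgrid_gt//.
rewrite (stepvalE kK' xk2).
have kL : `|level mu k.+1 - level mu k| <= L.
  have [_ _] := jmp (leq_ltn_trans (leq0n _) kK').
  apply: le_trans; rewrite /max_jump.
  by apply: (@bigmax_sup_seq _ _ _ _ _ k.+1) => //; rewrite mem_index_iota.
split=> //; apply: le_trans (_ : L ^+ 2 * 1 <= _).
  by rewrite mulr1 ler_sqr ?nnegrE.
rewrite ler_wpM2l ?sqr_ge0// (big_rem k.+1)/=; last by rewrite mem_index_iota.
by rewrite tk1 eqxx lerDl sumr_ge0.
Qed.

Lemma stepclass_jump (nu epsilon L : R) k : stepclass nu epsilon L mu ->
  (k < K)%N -> epsilon <= `|level mu k.+1 - level mu k| <= L.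
Proof.
move=> [_ jmp] kK; have [e1 _ e2] := jmp (leq_ltn_trans (leq0n _) kK).
apply/andP; split.
  apply: le_trans e1 _; rewrite /min_jump.
  by apply: (@bigmin_inf_seq _ _ _ _ _ k.+1) => //; rewrite mem_index_iota.
apply: le_trans e2; rewrite /max_jump.
by apply: (@bigmax_sup_seq _ _ _ _ _ k.+1) => //; rewrite mem_index_iota.
Qed.

Lemma stepclass_nchange (nu epsilon L : R) : stepclass nu epsilon L mu ->
  K.+1%:R * nu <= 1.
Proof.
move=> [nug _].
apply: (@le_trans _ _ (\sum_(0 <= k < K.+1) (tau mu k.+1 - tau mu k))); last first.
  by rewrite telescope_sumr// tau_last tau_first subr0.
rewrite mulr_natl -[K.+1]subn0 -sumr_const_nat; apply: ler_sum_nat => k /andP[_ kK].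
apply: le_trans nug _; rewrite /min_gap; apply: (@le_trans _ _ (gap mu k)).
  by apply: (@bigmin_inf_seq _ _ _ _ _ k) => //; rewrite mem_index_iota.
by rewrite /gap gtr0_norm// subr_gt0 tau_lt.
Qed.

End Discretize.


(** * Tails and local quantiles *)

Section NoiseTail.
Context {R : realType}.
Implicit Types (z : nat -> R) (T w : R).

Definition all_windows (n : nat) : seq (nat * nat) :=
  [seq (a, b) | a <- iota 0 n, b <- iota 0 n.+1].

Lemma size_all_windows n : size (all_windows n) = (n * n.+1)%N.
Proof. by rewrite size_allpairs !size_iota. Qed.

Lemma mem_all_windows n a b : (a < b)%N -> (b <= n)%N -> (a, b) \in all_windows n.
Proof.
move=> ab bn; apply/allpairsP; exists (a, b); rewrite !mem_iota; split=> //=; lia.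
Qed.

(** Chernoff's bound at parameter [T], with [|w|] on the left instead of 1: when the noise is large
    the loss is controlled only linearly in it, so the tail bound must carry that factor. *)
Lemma tail_le_expR T w : 1 <= T -> T < `|w| ->
  `|w| <= T * (expR (- T ^+ 2) * (expR (T * w) + expR (- T * w))).
Proof.
move=> T1 Tw; have T0 : 0 < T by exact: lt_le_trans T1.
have : `|w| <= T * expR (T * `|w| - T ^+ 2).
  have := expR_ge1Dx (T * `|w| - T ^+ 2).
  rewrite -(ler_pM2l T0); apply: le_trans.
  (* With [1 + u <= expR u] at [u = T * |w| - T ^+ 2], the claim reduces to the sign of this
     product. *)
  have : 0 <= (T ^+ 2 - 1) * (`|w| - T).
    by rewrite mulr_ge0 ?subr_ge0 ?exprn_ege1// ltW.
  by rewrite -subr_ge0; lra.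
move/le_trans; apply; rewrite ler_pM2l// expRD mulrC ler_wpM2l ?expR_ge0//.
have [w0|w0] := leP 0 w.
  by rewrite ger0_norm// lerDl expR_ge0.
by rewrite ltr0_norm// mulrN -mulNr lerDr expR_ge0.
Qed.

Lemma tail_le_expsum T z n a b : 1 <= T -> (a < b)%N -> (b <= n)%N ->
  T < `|chi z a b| ->
  `|chi z a b| <= T * (expR (- T ^+ 2) * expsum T z (all_windows n)).
Proof.
move=> T1 ab bn Tc; apply: le_trans (tail_le_expR T1 Tc) _.
have T0 : 0 <= T by exact: le_trans T1.
rewrite !ler_wpM2l ?expR_ge0//; apply: le_expsum; exact: mem_all_windows.
Qed.

Lemma one_le_expsum T z n a b : 1 <= T -> (a < b)%N -> (b <= n)%N ->
  T < `|chi z a b| -> 1 <= expR (- T ^+ 2) * expsum T z (all_windows n).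
Proof.
move=> T1 ab bn Tc; have T0 : 0 < T by exact: lt_le_trans T1.
rewrite -(ler_pM2l T0) mulr1; apply: le_trans (ltW Tc) _.
exact: tail_le_expsum ab bn Tc.
Qed.

End NoiseTail.

Section ResidualStatistic.
Context {R : realType}.

Definition mean (m : nat) (v : nat -> R) : R := (\sum_(0 <= l < m) v l) / m%:R.

(** Stated by a witness window instead of a supremum, which makes monotonicity in [q] and
    measurability immediate. *)
Definition residual_exceeds (m : nat) (q : R) (v : nat -> R) : Prop :=
  exists i j, [/\ (i < j)%N, (j <= m)%N & q < window_stat 1 m v (mean m v) i j].

Lemma residual_exceeds_eq m q v v' : (forall l, (l < m)%N -> v l = v' l) ->
  residual_exceeds m q v -> residual_exceeds m q v'.
Proof.
move=> vv [i [j [ij jm qw]]]; exists i, j; split => //.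
have meanE : mean m v = mean m v'.
  by rewrite /mean; congr (_ / _); apply: eq_big_nat => l /andP[_]; exact: vv.
have sumE : \sum_(i <= l < j) (v l - mean m v) = \sum_(i <= l < j) (v' l - mean m v').
  by apply: eq_big_nat => l /andP[_ lj]; rewrite meanE vv// (leq_trans lj).
by rewrite /window_stat -sumE.
Qed.

(** Below this threshold the event is certain, so the thresholds of level [alpha] are bounded from
    below. *)
Lemma residual_exceeds_full m q v : (0 < m)%N -> q < - pen (m%:R / m%:R : R) ->
  residual_exceeds m q v.
Proof.
move=> m0 qp; exists 0%N, m; split => //; apply: lt_le_trans qp _.
by rewrite /window_stat subn0 lerDr divr_ge0// mul1r sqrtr_ge0.
Qed.

Lemma residual_exceeds_mono m (q q' : R) v :
  q <= q' -> residual_exceeds m q' v -> residual_exceeds m q v.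
Proof.
move=> qq [i [j [ij jm qw]]]; exists i, j; split => //; exact: le_lt_trans qw.
Qed.

(** The normalised centred sum is [chi v i j] minus sqrt((j - i) / m) times [chi v 0 m], and [pen]
    is nonnegative; this is the origin of the factor 2 in [2 * T]. *)
Lemma residual_exceeds_noise m (T : R) v : (0 < m)%N -> residual_exceeds m (2 * T) v ->
  exists a b, [/\ (a < b)%N, (b <= m)%N & T < `|chi v a b|].
Proof.
move=> m0 [i [j [ij jm qw]]]; apply: contrapT => H.
have chiT a b : (a < b)%N -> (b <= m)%N -> `|chi v a b| <= T.
  by move=> ab bm; rewrite leNgt; apply/negP => Tc; apply: H; exists a, b.
move: qw; apply/negP; rewrite -leNgt /window_stat mul1r.
have l0 : 0 < (j - i)%:R :> R by rewrite ltr0n subn_gt0.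
have m0' : 0 < m%:R :> R by rewrite ltr0n.
have s0 : 0 < Num.sqrt (j - i)%:R :> R by rewrite sqrtr_gt0.
have sm0 : 0 < Num.sqrt m%:R :> R by rewrite sqrtr_gt0.
have sE : (j - i)%:R = Num.sqrt (j - i)%:R ^+ 2 :> R by rewrite sqr_sqrtr// ltW.
have smE : m%:R = Num.sqrt m%:R ^+ 2 :> R by rewrite sqr_sqrtr// ltW.
rewrite sumrB sumr_const_nat -/(wsum v i j) /mean -/(wsum v 0 m).
rewrite lerBlDr ler_wpDr ?sqrtr_ge0//.
have -> : wsum v i j = chi v i j * Num.sqrt (j - i)%:R.
  by rewrite /chi divfK// gt_eqF.
have -> : wsum v 0 m = chi v 0 m * Num.sqrt m%:R.
  by rewrite /chi subn0 divfK// gt_eqF.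
have c1 := chiT _ _ ij jm; have c2 := chiT _ _ m0 (leqnn m).
have ss : Num.sqrt (j - i)%:R <= Num.sqrt m%:R :> R.
  by apply: ler_wsqrtr; rewrite ler_nat (leq_trans (leq_subr _ _)).
rewrite -[X in `|_ - X|]mulr_natl ler_pdivrMr//.
move: c1 c2 ss s0 sm0 sE smE; move: (chi _ _ _) (chi _ _ _) => y x.
move: (Num.sqrt _) (Num.sqrt _) => sm s c1 c2 ss s0 sm0 -> ->.
apply: le_trans (ler_normB _ _) _.
have b1 : `|x * s| <= T * s by rewrite normrM (gtr0_norm s0) ler_wpM2r// ltW.
have b2 : `|s ^+ 2 * (y * sm / sm ^+ 2)| <= T * s.
  have -> : s ^+ 2 * (y * sm / sm ^+ 2) = y * (s / sm) * s by field; rewrite gt_eqF.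
  rewrite normrM (gtr0_norm s0) ler_wpM2r ?(ltW s0)// normrM -[leRHS]mulr1.
  apply: ler_pM => //; rewrite gtr0_norm ?divr_gt0//.
  by rewrite ler_pdivrMr// mul1r.
lra.
Qed.

Lemma sum_nat_shift (a i j : nat) (F : nat -> R) :
  \sum_(a + i <= l < a + j) F l = \sum_(i <= l < j) F (a + l)%N.
Proof.
rewrite ![(a + _)%N]addnC big_addn addnK.
by apply: eq_bigr => l _; rewrite addnC.
Qed.

(** Centring at the local mean removes [c] and the normalisation removes [sigma], so only the noise
    is left. The case [c = 0], [sigma = 1] is the event in [local_quantile]; the general case is a
    true segment. *)
Lemma residual_exceeds_multiscale n a b (q c sigma : R) (Y : n.-tuple R) (z : nat -> R) :
  (a < b <= n)%N -> 0 < sigma ->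
  (forall l, (a <= l < b)%N -> nth 0 Y l = c + sigma * z l) ->
  q < multiscale sigma `[grid n a, grid n b[%classic Y
        (local_mean `[grid n a, grid n b[%classic Y) <->
  residual_exceeds (b - a) q (fun l => z (a + l)%N).
Proof.
move=> abn s0 YE; have /andP[ab bn] := abn; have n0 : (0 < n)%N by lia.
rewrite multiscale_gt// local_mean_grid//.
have ba0 : (b - a)%:R != 0 :> R by rewrite pnatr_eq0 subn_eq0 -ltnNge.
have meanE : (\sum_(a <= l < b) nth 0 Y l) / (b - a)%:R =
    c + sigma * mean (b - a) (fun l => z (a + l)%N).
  rewrite (eq_big_nat _ _ (F2 := fun l => c + sigma * z l))//.
  rewrite big_split/= sumr_const_nat -mulr_sumr /mean.
  rewrite -sum_nat_shift addn0 subnKC; last exact: ltnW.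
  by rewrite mulrDl -[c *+ _]mulr_natr mulfK// mulrA.
have statE i j : (i < j)%N -> (j <= b - a)%N ->
  window_stat sigma (b - a) (nth 0 Y)
    (c + sigma * mean (b - a) (fun l => z (a + l)%N)) (a + i) (a + j) =
  window_stat 1 (b - a) (fun l => z (a + l)%N) (mean (b - a) (fun l => z (a + l)%N)) i j.
  move=> ij jb; rewrite /window_stat subnDl; congr (_ - _).
  set mz := mean _ _.
  rewrite (eq_big_nat _ _ (F2 := fun l => sigma * (z l - mz))); last first.
    by move=> l /andP[al lb]; rewrite YE; [ring | lia].
  rewrite -mulr_sumr normrM gtr0_norm// mul1r invfM mulrACA divff ?gt_eqF// mul1r.
  by rewrite sum_nat_shift.
rewrite meanE; split.
  move=> [i [j [ai ij jb qw]]]; exists (i - a)%N, (j - a)%N.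
  split; [lia | lia |].
  rewrite -statE; [|lia|lia].
  by rewrite !subnKC//; lia.
move=> [i [j [ij jb qw]]]; exists (a + i)%N, (a + j)%N.
by rewrite statE//; split => //; lia.
Qed.

End ResidualStatistic.


Section Quantile.
Context {R : realType} d (Omega : measurableType d) (P : probability Omega R).

Definition exceed_set (m : nat) (q : R) : set (m.-tuple R) :=
  [set v | residual_exceeds m q (nth 0 v)].
Arguments exceed_set : clear implicits.

Lemma measurable_nth_tuple m (l : nat) :
  measurable_fun setT (fun v : m.-tuple R => nth 0 v l).
Proof.
have [lm|ml] := ltnP l m.
  rewrite (_ : (fun v => _) = (@tnth m R)^~ (Ordinal lm)).
    exact: measurable_tnth.
  by apply/funext => v; rewrite (tnth_nth 0).
rewrite (_ : (fun v => _) = cst 0) //.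
by apply/funext => v; rewrite nth_default// size_tuple.
Qed.

Lemma measurable_exceed_set m q : measurable (exceed_set m q).
Proof.
pose F i j (v : m.-tuple R) := window_stat 1 m (nth 0 v) (mean m (nth 0 v)) i j.
have mF i j : measurable_fun setT (F i j).
  apply: measurable_funB => //; apply: measurable_funM => //.
  apply: measurableT_comp => //; apply: measurable_sum => l.
  apply: measurable_funB; first exact: measurable_nth_tuple.
  apply: measurable_funM => //; apply: measurable_sum => k.
  exact: measurable_nth_tuple.
rewrite (_ : exceed_set m q = \bigcup_i \bigcup_j
  (if (i < j)%N && (j <= m)%N then F i j @^-1` `]q, +oo[%classic else set0)).
  apply: bigcupT_measurable => i; apply: bigcupT_measurable => j.
  case: ifP => // _; rewrite -[_ @^-1` _]setTI; apply: mF => //.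
apply/seteqP; split=> v.
  move=> [i [j [ij jm qF]]]; exists i => //; exists j => //.
  by rewrite ij jm/= in_itv/= andbT.
move=> [i _ [j _]]; case: ifP => // /andP[ij jm]; rewrite /= in_itv/= andbT => qF.
by exists i, j.
Qed.

Variables (n : nat) (e : 'I_n -> {RV P >-> R}).
Hypothesis iid_e : iid_std_normal e.

Definition exceed_event (a m : nat) (q : R) : set Omega :=
  [set w | residual_exceeds m q (fun l => ext (e ^~ w) (a + l)%N)].

Let shift_lt a m (am : (a + m <= n)%N) (i : 'I_m) : (a + i < n)%N.
Proof. by apply: leq_trans am; rewrite ltn_add2l. Qed.

Let shift a m (am : (a + m <= n)%N) (i : 'I_m) : 'I_n := Ordinal (shift_lt am i).

Let shift_inj a m (am : (a + m <= n)%N) : injective (shift am).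
Proof. by move=> i j /(congr1 val)/= /addnI /val_inj. Qed.

Lemma exceed_event_preimage a m (am : (a + m <= n)%N) q :
  exceed_event a m q = rvtuple (fun i : 'I_m => e (shift am i)) @^-1` exceed_set m q.
Proof.
have vE w l : (l < m)%N -> ext (e ^~ w) (a + l)%N =
    nth 0 (rvtuple (fun i : 'I_m => e (shift am i)) w) l.
  move=> lm; rewrite -(tnth_nth 0 _ (Ordinal lm)) tnth_mktuple.
  by rewrite (ext_Ordinal _ (shift_lt am (Ordinal lm))).
apply/seteqP; split=> w; apply: residual_exceeds_eq => l lm.
  exact: vE.
by rewrite vE.
Qed.

Lemma measurable_exceed_event a m q : (a + m <= n)%N -> measurable (exceed_event a m q).
Proof.
move=> am; rewrite (exceed_event_preimage am) -[_ @^-1` _]setTI.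
by apply: measurable_rvtuple => //; exact: measurable_exceed_set.
Qed.

Lemma exceed_event_shift a m q : (a + m <= n)%N -> P (exceed_event a m q) = P (exceed_event 0 m q).
Proof.
move=> am; have m0n : (0 + m <= n)%N by apply: leq_trans am; rewrite leq_add2r.
rewrite (exceed_event_preimage am) (exceed_event_preimage m0n).
apply: iid_std_normal_law; last exact: measurable_exceed_set.
  by apply: iid_std_normal_comp => //; exact: shift_inj.
by apply: iid_std_normal_comp => //; exact: shift_inj.
Qed.

Lemma local_quantile_inf alpha m : (0 < m)%N -> (m <= n)%N ->
  local_quantile P e alpha m = inf [set q | (P (exceed_event 0 m q) <= alpha%:E)%E].
Proof.
move=> m0 mn; rewrite /local_quantile; congr inf; apply/funext => q /=.
congr (P _ <= _)%E; apply/funext => w; apply/propext => /=.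
have g0 : grid n 0 = 0 :> R by rewrite /grid mul0r.
rewrite -{1 2}g0; set Y := [tuple _ | _ < _].
have m0n : (0 < m <= n)%N by rewrite m0.
have YE l : (0 <= l < m)%N -> nth 0 Y l = 0 + 1 * ext (e ^~ w) l.
  move=> /andP[_ lm]; rewrite add0r mul1r (ext_Ordinal _ (leq_trans lm mn)).
  by rewrite -(tnth_nth 0 _ (Ordinal (leq_trans lm mn))) tnth_mktuple.
by rewrite (residual_exceeds_multiscale _ m0n ltr01 YE) subn0.
Qed.

Section Level.
Variables (alpha T : R) (m : nat).
Hypotheses (alpha01 : 0 < alpha < 1) (m_gt0 : (0 < m)%N) (mn : (m <= n)%N).
Hypothesis tailT : (P (exceed_event 0 m (2 * T)) <= alpha%:E)%E.

Let S := [set q | (P (exceed_event 0 m q) <= alpha%:E)%E].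

Let m0n : (0 + m <= n)%N. Proof. by []. Qed.

Let S_up q q' : q <= q' -> S q -> S q'.
Proof.
move=> qq; apply: le_trans; apply: le_measure; rewrite ?inE;
  try exact: measurable_exceed_event.
by move=> w; exact: residual_exceeds_mono.
Qed.

Let S_inf : has_inf S.
Proof.
split; first by exists (2 * T).
exists (- pen (m%:R / m%:R)) => q Sq; rewrite leNgt; apply/negP => qp.
move: Sq; rewrite /S/= (_ : exceed_event 0 m q = setT); last first.
  by apply/seteqP; split => // w _; exact: residual_exceeds_full.
rewrite probability_setT lee_fin leNgt.
by case/andP: alpha01 => _ ->.
Qed.

Lemma local_quantile_le : local_quantile P e alpha m <= 2 * T.
Proof. by rewrite local_quantile_inf//; apply: ge_inf => //; case: S_inf. Qed.

(** The exceedance is strict, so the event at the infimum is the increasing union of the events at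
    [inf S + 1 / (k + 1)], each of probability at most [alpha]; continuity from below passes to the
    limit. *)
Lemma local_quantile_level : (P (exceed_event 0 m (local_quantile P e alpha m)) <= alpha%:E)%E.
Proof.
rewrite local_quantile_inf// -/S.
have Sk k : S (inf S + k.+1%:R^-1).
  have k0 : 0 < k.+1%:R^-1 :> R by rewrite invr_gt0 ltr0n.
  have [s Ss sk] := inf_adherent k0 S_inf.
  exact: S_up (ltW sk) Ss.
pose A k := exceed_event 0 m (inf S + k.+1%:R^-1).
have AE : exceed_event 0 m (inf S) = \bigcup_k A k.
  apply/seteqP; split=> w.
    move=> [i [j [ij jm qF]]].
    have [k kF] : exists k, inf S + k.+1%:R^-1 <
        window_stat 1 m (fun l => ext (e ^~ w) (0 + l)%N)
          (mean m (fun l => ext (e ^~ w) (0 + l)%N)) i j.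
      set x := window_stat _ _ _ _ _ _ in qF *.
      exists (Num.truncn (x - inf S)^-1).
      have x0 : 0 < x - inf S by rewrite subr_gt0.
      rewrite addrC -ltrBrDr invf_plt ?posrE ?ltr0n//.
      exact: truncnS_gt.
    by exists k => //; exists i, j.
  move=> [k _]; apply: residual_exceeds_mono.
  by rewrite lerDl invr_ge0 ler0n.
have mA k : measurable (A k) by exact: measurable_exceed_event.
have cvgA : P (A k) @[k --> \oo] --> P (\bigcup_k A k).
  apply: nondecreasing_cvg_mu => //; first exact: bigcupT_measurable.
  move=> k k' kk; apply/subsetPset => w.
  apply: residual_exceeds_mono; rewrite lerD2l lef_pV2 ?posrE ?ltr0n// ler_nat.
  exact: kk.
rewrite AE -(cvg_lim _ cvgA)//; apply: lime_le.
  by apply/cvg_ex; eexists; exact: cvgA.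
by apply: nearW => k; exact: Sk.
Qed.

End Level.

(** Some window exceeds [T] on this event; Chernoff's bound over the [n * n.+1] listed windows gives
    the estimate. *)
Lemma exceed_event_tail (T : R) m : (0 < m)%N -> (m <= n)%N -> 1 <= T ->
  (P (exceed_event 0 m (2 * T)) <= ((n * n.+1)%:R * (2 * expR (- T ^+ 2 / 2)))%:E)%E.
Proof.
move=> m0 mn T1.
have mr : measurable (exceed_event 0 m (2 * T)) by exact: measurable_exceed_event.
pose g w := expR (- T ^+ 2) * expsum T (ext (e ^~ w)) (all_windows n).
apply: (@le_trans _ _ (\int[P]_w (g w)%:E)%E).
  rewrite -(setIT (exceed_event _ _ _)) -integral_indic//; apply: ge0_le_integralT => w.
    by rewrite lee_fin indicE.
  rewrite lee_fin indicE; have [wr|wr] := boolP (w \in _); last first.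
    by rewrite mulr_ge0 ?expR_ge0 ?expsum_ge0.
  move/set_mem : wr => /(residual_exceeds_noise m0)[a [b [ab bm Tc]]].
  exact: one_le_expsum T1 ab (leq_trans bm mn) Tc.
under eq_integral do rewrite EFinM.
rewrite ge0_integralZl//.
- apply: le_trans (lee_pmul _ _ (lexx _) (std_normal_expsum T (all_windows n) iid_e)) _.
  + by rewrite lee_fin expR_ge0.
  + by apply: integral_ge0 => w _; rewrite lee_fin expsum_ge0.
  rewrite -EFinM lee_fin size_all_windows mulrCA ler_wpM2l//.
  rewrite mulrCA ler_wpM2l// -expRD ler_expR; lra.
- by apply/measurable_EFinP; exact: measurable_expsum.
- by move=> w _; rewrite lee_fin expsum_ge0.
Qed.

End Quantile.

Lemma sum_sqr_mean_le (R : realType) (a b : nat) (y : nat -> R) (c : R) :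
  (a < b)%N ->
  \sum_(a <= l < b) (y l - (\sum_(a <= k < b) y k) / (b - a)%:R) ^+ 2 <=
  \sum_(a <= l < b) (y l - c) ^+ 2.
Proof.
move=> ab; have ba0 : (b - a)%:R != 0 :> R by rewrite pnatr_eq0 subn_eq0 -ltnNge.
set ym := _ / _; rewrite -subr_ge0 -sumrB.
rewrite (eq_big_nat _ _ (F2 := fun l => 2 * (ym - c) * y l - (ym ^+ 2 - c ^+ 2))).
  rewrite sumrB -mulr_sumr sumr_const_nat.
  have -> : \sum_(a <= l < b) y l = ym * (b - a)%:R by rewrite /ym divfK.
  rewrite -(mulr_natr (ym ^+ 2 - c ^+ 2)).
  have -> : 2 * (ym - c) * (ym * (b - a)%:R) - (ym ^+ 2 - c ^+ 2) * (b - a)%:R =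
    (ym - c) ^+ 2 * (b - a)%:R by ring.
  by rewrite mulr_ge0 ?sqr_ge0.
by move=> l _; ring.
Qed.

(** * The estimator *)

Section Estimator.
Context {R : realType}.
Variables (mu : stepfun R) (n r : nat) (nu epsilon L sigma T : R).
Variables (q : nat -> R) (f : R -> R) (noise : 'I_n -> R).
Local Notation K := (nchange mu).
Local Notation z := (ext noise).
Local Notation t := (tgrid mu n).
Local Notation m := (fun l => stepval mu (grid n l)).
Let Y : n.-tuple R := [tuple stepval mu (grid n i) + sigma * noise i | i < n].
Hypotheses (n_gt0 : (0 < n)%N) (r_gt0 : (0 < r)%N).
Hypotheses (sigma0 : 0 < sigma) (epsL : 0 < epsilon < L) (T1 : 1 <= T).
Hypotheses (mu_class : stepclass nu epsilon L mu).
Hypothesis gap_r : (4 * r).+1%:R <= n%:R * nu.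
Hypothesis penT : forall w k, (0 < w)%N -> (w <= k)%N -> (k <= n)%N ->
  pen (w%:R / k%:R : R) <= T.
Hypothesis qT : forall k, (0 < k)%N -> (k <= n)%N -> q k <= 2 * T.
Hypothesis rT : 8 * sigma * T < epsilon * Num.sqrt r%:R.
Hypothesis f_est : is_FDRSeg sigma q Y f.

Let YE l : (l < n)%N -> nth 0 Y l = m l + sigma * z l.
Proof.
by move=> ln; rewrite -(tnth_nth 0 _ (Ordinal ln)) tnth_mktuple (ext_Ordinal _ ln).
Qed.

Let t_gap k : (k <= K)%N -> (t k + 4 * r <= t k.+1)%N.
Proof. by case: mu_class => nug _ kK; apply: (tgrid_gap n_gt0 kK nug). Qed.

Let t_lt k : (k <= K)%N -> (t k < t k.+1)%N.
Proof. by move=> /t_gap; lia. Qed.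

Let t_le_n k : (k <= K.+1)%N -> (t k <= n)%N.
Proof. by move=> kK; rewrite -{2}(tgrid_last mu n); exact: (incr_homo_le t_lt). Qed.

Let mE k l : (k <= K)%N -> (t k <= l < t k.+1)%N -> m l = level mu k.
Proof. by move=> kK; exact: stepval_grid. Qed.

Lemma candidate_pieces k g : candidates sigma q Y k g ->
  exists (b : nat -> nat) (c : nat -> R), [/\ b 0%N = 0%N, b k.+1 = n,
    (forall i, (i <= k)%N -> (b i < b i.+1)%N),
    (forall i, (i <= k)%N -> feasible (nth 0 Y) sigma q (b i) (b i.+1) (c i)) &
    (forall i x, (i <= k)%N -> grid n (b i) <= x < grid n (b i.+1) -> g x = c i)].
Proof.
move=> [b [c /= [b0 bn b_lt bq ->]]]; exists b, c.
have b_le i : (i <= k)%N -> (b i < b i.+1 <= n)%N.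
  by move=> ik; rewrite b_lt// -bn (incr_homo_le b_lt).
split=> // [i ik|i x ik ix].
  have := bq i ik; rewrite npoints_grid; last by case/andP: (b_le i ik).
  by move/(multiscale_le _ _ _ _ (b_le i ik)).
apply: (@sum_indic_itv _ (fun i => grid n (b i))) => // j jk.
by rewrite ler_grid// ltnW// b_lt.
Qed.

(** The one-point window at [l] already ties the fitted level to the observation. No bound on the
    noise enters, so this also controls the loss off the good event. *)
Lemma estimator_cell l x : (l < n)%N -> grid n l <= x < grid n l.+1 ->
  f x = f (grid n l) /\ `|f (grid n l) - m l| <= 3 * sigma * T + sigma * `|z l|.
Proof.
move=> ln /andP[lx xl]; case: f_est => Kh [_ _ /candidate_pieces + _].
move=> [b [c [b0 bn b_lt b_feas fE]]].
have ln' : (l < b Kh.+1)%N by rewrite bn.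
have [j jK /andP[bj lb]] := locate_block b0 ln'.
have bjn : (b j.+1 <= n)%N by rewrite -bn (incr_homo_le b_lt).
have fx : f x = c j.
  apply: fE => //; rewrite (le_trans _ lx) ?ler_grid//=.
  by rewrite (lt_le_trans xl)// ler_grid.
have fl : f (grid n l) = c j by apply: fE => //; rewrite ler_grid// ltr_grid// bj.
rewrite fx fl; split=> //.
have := b_feas j jK l l.+1 bj (ltnSn l) lb; rewrite /window_stat subSnn big_nat1 sqrtr1 mulr1.
have ba0 : (0 < b j.+1 - b j)%N by lia.
have ban : (b j.+1 - b j <= n)%N by lia.
have := qT ba0 ban; have := penT (ltn0Sn 0) ba0 ban.
rewrite YE//; set pp := pen _ => ppT qqT H.
have {}H : `|m l + sigma * z l - c j| <= 3 * T * sigma.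
  by rewrite -ler_pdivrMr//; move: H => /=; lra.
have -> : c j - m l = sigma * z l - (m l + sigma * z l - c j) by ring.
apply: le_trans (ler_normB _ _) _.
by rewrite normrM (gtr0_norm sigma0) mulrAC addrC lerD2r.
Qed.

Lemma loss_le l x : (l < n)%N -> grid n l <= x < grid n l.+1 ->
  `|f x - stepval mu x| <= L + 3 * sigma * T + sigma * `|z l|.
Proof.
move=> ln lx; have [fx fl] := estimator_cell ln lx.
have L0 : 0 <= L by have /andP[e0 eL] := epsL; apply/ltW/(lt_trans e0).
have nn : 2 <= n%:R * nu by apply: le_trans gap_r; rewrite ler_nat ltnS muln_gt0.
have [_ ml] := stepval_cell n_gt0 ln L0 mu_class nn lx.
rewrite fx.
have -> : f (grid n l) - stepval mu x =
  (f (grid n l) - m l) - (stepval mu x - m l) by ring.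
by apply: le_trans (ler_normB _ _) _; lra.
Qed.

Hypothesis zT : forall a b, (a < b)%N -> (b <= n)%N -> `|chi z a b| <= T.
Hypothesis true_feas : forall k, (k <= K)%N ->
  ~ residual_exceeds (t k.+1 - t k) (q (t k.+1 - t k)) (fun l => z (t k + l)%N).

Let tI k : set R := `[grid n (t k), grid n (t k.+1)[%classic.

Lemma true_candidate : candidates sigma q Y K
  (fun x => \sum_(k < K.+1) local_mean (tI k) Y * \1_(tI k) x).
Proof.
exists t, (fun k => local_mean (tI k) Y); split => //.
- exact: tgrid_first.
- exact: tgrid_last.
move=> k kK; rewrite npoints_grid; last exact: t_le_n.
rewrite leNgt; apply/negP => H; apply: (true_feas kK); move: H.
have tt : (t k < t k.+1 <= n)%N by rewrite t_lt// t_le_n.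
apply: (residual_exceeds_multiscale _ tt sigma0 _).1 => l lt.
have ln : (l < n)%N by case/andP: lt => _ lt'; exact: leq_trans lt' (t_le_n _).
by rewrite YE// (mE kK lt).
Qed.

Lemma rss_grid g : rss Y g = \sum_(0 <= l < n) (nth 0 Y l - g (grid n l)) ^+ 2.
Proof. by rewrite /rss big_mkord; apply: eq_bigr => i _; rewrite (tnth_nth 0). Qed.

Lemma good_fit (x : R) : 0 < x ->
  (forall l, (l < n)%N -> `|f (grid n l) - m l| <= 2 * L) /\
  \sum_(0 <= l < n) (f (grid n l) - m l) ^+ 2 <= 4 * sigma ^+ 2 *
    \sum_(0 <= k < K.+1) (3 * x + 3 * c6 / x ^+ 2 * expsum 1 z (near_windows r t k)).
Proof.
move=> x0; case: f_est => Kh [_ Kmin fK fmin].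
have KhK := Kmin K (ex_intro _ _ true_candidate).
have [b [c [b0 bn b_lt b_feas fE]]] := candidate_pieces fK.
have fhE i l : (i <= Kh)%N -> (b i <= l < b i.+1)%N -> f (grid n l) = c i.
  by move=> iK bl; apply: fE => //; rewrite ler_grid// ltr_grid.
have t0 := tgrid_first mu n; have tK := tgrid_last mu n.
have jmp k : (k < K)%N -> epsilon <= `|level mu k.+1 - level mu k| <= L.
  exact: (stepclass_jump mu_class).
have YE' := YE; have mE' := mE.
have KE : Kh = K.
  exact: (nchange_correct t0 tK r_gt0 t_gap sigma0 epsL jmp mE' YE' zT penT qT
    rT b0 bn b_lt b_feas KhK).
split.
  exact: (fit_error_le t0 tK r_gt0 t_gap sigma0 epsL jmp mE' YE' zT penT qT
    rT b0 bn b_lt b_feas KhK fhE).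
apply: (fit_error_expsum t0 tK r_gt0 t_gap sigma0 epsL jmp mE' YE' zT penT qT
    rT b0 bn b_lt b_feas KhK fhE) => //.
(* The feasible candidate carries the segment means; as these minimise the residuals on each block,
   its residual sum of squares is at most that of the true signal. *)
have := fmin _; rewrite KE => /(_ _ true_candidate); rewrite !rss_grid => H.
apply: le_trans H _.
have tm k : (k < K.+1)%N -> (t k <= t k.+1)%N by move=> kK; exact/ltnW/t_lt.
have blk (G : nat -> R) : \sum_(0 <= l < n) G l =
    \sum_(0 <= k < K.+1) \sum_(t k <= l < t k.+1) G l.
  by rewrite -[in LHS]tK -{1}t0 sum_blocks.
rewrite !blk !big_nat.
apply: ler_sum => k /andP[_ kK].
have tkn : (t k.+1 <= n)%N by exact: t_le_n.
rewrite (eq_big_nat _ _ (F2 := fun l => (nth 0 Y l - local_mean (tI k) Y) ^+ 2)).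
  rewrite [leRHS](eq_big_nat _ _ (F2 := fun l => (nth 0 Y l - level mu k) ^+ 2)).
    by rewrite local_mean_grid//; apply: sum_sqr_mean_le; exact: t_lt.
  by move=> l lk; rewrite (mE kK lk).
move=> l lk; congr ((_ - _) ^+ 2).
apply: (@sum_indic_itv _ (fun k => grid n (t k)) (fun k => local_mean (tI k) Y)) => //.
  by move=> i iK; rewrite ler_grid// tm.
by rewrite ler_grid// ltr_grid.
Qed.

End Estimator.

(** * Risk *)

Section LpNorm.
Context {R : realType}.
Implicit Types (f h : R -> R) (n l : nat).

Let leb01 := mrestr (@lebesgue_measure R) (measurable_itv `[0, 1[).

Lemma unit_cell n (x : R) : (0 < n)%N -> 0 <= x < 1 ->
  exists2 l, (l < n)%N & grid n l <= x < grid n l.+1.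
Proof.
move=> n0 /andP[x0 x1]; have n0' : 0 < n%:R :> R by rewrite ltr0n.
have nx0 : 0 <= x * n%:R by rewrite mulr_ge0// ltW.
have /andP[h1 h2] := truncn_itv nx0.
exists (Num.truncn (x * n%:R)).
  by rewrite truncn_lt_nat// -[ltRHS]mul1r ltr_pM2r.
by rewrite /grid ler_pdivrMr// ltr_pdivlMr// h1 h2.
Qed.

Lemma integral_cells_le n (V : nat -> R) h : (0 < n)%N ->
  (forall x, 0 <= h x) -> (forall l, (l < n)%N -> 0 <= V l) ->
  (forall l x, (l < n)%N -> grid n l <= x < grid n l.+1 -> h x <= V l) ->
  (\int[leb01]_x (h x)%:E <= ((\sum_(0 <= l < n) V l) / n%:R)%:E)%E.
Proof.
move=> n0 h0 V0 hV.
have n0' : 0 < n%:R :> R by rewrite ltr0n.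
pose cell l : set R := `[grid n l, grid n l.+1[%classic.
pose out : set R := ~` `[0, 1[%classic.
have mout : measurable out by apply: measurableC; exact: measurable_itv.
(* The comparison must hold on the whole line: off [[0, 1[] the majorant is [+oo], which costs
   nothing because the restricted measure vanishes there. *)
pose G x := (\sum_(l < n) (V l)%:E * (\1_(cell l) x)%:E + +oo * (\1_out x)%:E)%E.
have cell_ge0 l x : (l < n)%N -> (0 <= (V l)%:E * (\1_(cell l) x)%:E)%E.
  by move=> ln; rewrite -EFinM lee_fin mulr_ge0 ?V0// indicE.
have hG x : ((h x)%:E <= G x)%E.
  have [x01|x01] := boolP (x \in out).
    rewrite /G indicE x01 mule1 addey ?leey// gt_eqF// (@lt_le_trans _ _ 0%E)//.
    by apply: sume_ge0 => i _; exact: cell_ge0.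
  have {}x01 : 0 <= x < 1.
    by apply: contrapT => H; move/negP : x01; apply; apply/mem_set; rewrite /out/= in_itv/=.
  have [l ln lx] := unit_cell n0 x01.
  rewrite /G (bigD1 (Ordinal ln))//= indicE mem_set; last by rewrite /cell/= in_itv.
  rewrite mule1 -[leLHS]adde0 -[leLHS]adde0; apply: leeD; last first.
    by rewrite mule_ge0// lee_fin indicE.
  apply: leeD; first by rewrite lee_fin hV.
  by apply: sume_ge0 => i _; exact: cell_ge0.
apply: le_trans (ge0_le_integralT leb01 _ hG) _.
  by move=> x; rewrite lee_fin.
have mcell l : measurable_fun setT (fun x : R => ((V l)%:E * (\1_(cell l) x)%:E)%E).
  apply/measurable_funeM/measurable_EFinP; apply: measurable_indic; exact: measurable_itv.
have mout1 : measurable_fun setT (fun x : R => (\1_out x)%:E : \bar R).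
  by apply/measurable_EFinP; exact: measurable_indic.
have ge_out x : (0 <= (\1_out x)%:E :> \bar R)%E by rewrite lee_fin indicE.
have msum : measurable_fun setT (fun x => \sum_(l < n) (V l)%:E * (\1_(cell l) x)%:E)%E.
  by apply: emeasurable_sum => l; exact: mcell.
have sum_ge x : (0 <= \sum_(l < n) (V l)%:E * (\1_(cell l) x)%:E)%E.
  by apply: sume_ge0 => i _; exact: cell_ge0.
have mout2 : measurable_fun setT (fun x : R => (+oo * (\1_out x)%:E)%E : \bar R).
  exact: measurable_funeM.
have ge_out2 x : (0 <= (+oo * (\1_out x)%:E : \bar R))%E by rewrite mule_ge0.
rewrite /G ge0_integralD//=.
have -> : (\int[leb01]_x (+oo * (\1_out x)%:E) = 0)%E.
  rewrite ge0_integralZl// integral_indic// setIT.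
  rewrite [X in (_ * X)%E](_ : _ = 0%E) ?mule0//.
  by rewrite /= /mrestr /out setICl measure0.
rewrite adde0 ge0_integral_sum//; [|by move=> i; exact: mcell|by move=> i x _; exact: cell_ge0].
rewrite big_mkord mulr_suml -sumEFin; apply: lee_sum => l _.
have mc1 : measurable_fun setT (fun x : R => (\1_(cell l) x)%:E : \bar R).
  by apply/measurable_EFinP; apply: measurable_indic; exact: measurable_itv.
have c_ge x : (0 <= (\1_(cell l) x)%:E :> \bar R)%E by rewrite lee_fin indicE.
have V_ge : (0 <= (V l)%:E)%E by rewrite lee_fin V0.
rewrite ge0_integralZl// integral_indic//; last exact: measurable_itv.
rewrite setIT EFinM lee_wpmul2l// ?lee_fin ?V0//.
apply: (@le_trans _ _ (lebesgue_measure (cell l))).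
  rewrite /leb01 /mrestr; apply: le_measure; rewrite ?inE//.
  - by apply: measurableI; exact: measurable_itv.
  - exact: measurable_itv.
rewrite /cell lebesgue_measure_itv/= lte_fin ltr_grid// ltnSn -EFinB lee_fin.
by rewrite /grid -mulrBl -natr1 addrAC subrr add0r mul1r.
Qed.

Lemma Lp_norm01_le (p C : R) f : 1 <= p -> 0 <= C ->
  (\int[leb01]_x (`|f x| `^ p)%:E <= C%:E)%E ->
  (Lp_norm01 p f <= (C `^ p^-1)%:E)%E.
Proof.
move=> p1 C0 fC; rewrite /Lp_norm01 unlock /= -poweR_EFin.
have p0 : 0 < p by exact: lt_le_trans p1.
apply: gt0_ler_poweR.
- by rewrite invr_ge0 ltW.
- rewrite in_itv/= leey andbT; apply: integral_ge0 => x _.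
  by rewrite lee_fin powR_ge0.
- by rewrite in_itv/= leey andbT lee_fin.
exact: fC.
Qed.

Lemma Lp_norm01_sup (p C : R) f n : (0 < n)%N -> 1 <= p -> 0 <= C ->
  (forall l x, (l < n)%N -> grid n l <= x < grid n l.+1 -> `|f x| <= C) ->
  (Lp_norm01 p f <= C%:E)%E.
Proof.
move=> n0 p1 C0 fC; have p0 : 0 < p by exact: lt_le_trans p1.
rewrite -(powRr1 C0) -(divff (lt0r_neq0 p0)) powRrM.
apply: Lp_norm01_le => //; first exact: powR_ge0.
apply: le_trans (@integral_cells_le n (fun=> C `^ p) _ n0 _ _ _) _.
- by move=> x; exact: powR_ge0.
- by move=> l _; exact: powR_ge0.
- by move=> l x ln lx; rewrite ge0_ler_powR ?nnegrE ?(fC l)// ltW.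
- by rewrite sumr_const_nat subn0 -[_ *+ n]mulr_natr mulfK// pnatr_eq0 -lt0n.
Qed.

(** For [p >= 2], |f|^p <= B^(p-2) |f|^2. For [p < 2], with [eta] the square root of [X], |f|^p <=
    eta^p + eta^(p-2) |f|^2, by comparing |f| with [eta]. This pointwise bound replaces Hölder's
    inequality, since [f] need not be measurable. *)
Lemma Lp_norm01_interpolation (p B X : R) f n (g : nat -> R) :
  (0 < n)%N -> 1 <= p -> 1 <= B -> 0 < X ->
  (forall l, (l < n)%N -> 0 <= g l) ->
  (forall l x, (l < n)%N -> grid n l <= x < grid n l.+1 -> `|f x| <= B) ->
  (forall l x, (l < n)%N -> grid n l <= x < grid n l.+1 -> `|f x| ^+ 2 <= g l) ->
  (\sum_(0 <= l < n) g l) / n%:R <= X ->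
  (Lp_norm01 p f <= (2 * B * X `^ Num.min (1 / 2) (1 / p))%:E)%E.
Proof.
move=> n0 p1 B1 X0 g0 fB fg gX; have p0 : 0 < p by exact: lt_le_trans p1.
have B0 : 0 < B by exact: lt_le_trans B1.
have sqrE (y : R) : 0 <= y -> y ^+ 2 = y `^ 2.
  by move=> y0; rewrite -(powR_mulrn 2 y0).
have powE (y : R) : 0 < y -> y `^ p = y `^ (p - 2) * y ^+ 2.
  move=> y0; rewrite sqrE ?(ltW y0)// -powRD; last by apply/implyP => _; exact: lt0r_neq0.
  by rewrite subrK.
have n0' : 0 < n%:R :> R by rewrite ltr0n.
have [p2|p2] := leP 2 p.
  rewrite (_ : Num.min _ _ = p^-1); last first.
    by rewrite !div1r; apply/min_idPr; rewrite lef_pV2 ?posrE.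
  apply: (@le_trans _ _ ((B `^ p * X) `^ p^-1)%:E).
    apply: Lp_norm01_le => //; first by rewrite mulr_ge0 ?powR_ge0 ?ltW.
    apply: le_trans (@integral_cells_le n (fun l => B `^ p * g l) _ n0 _ _ _) _.
    - by move=> x; exact: powR_ge0.
    - by move=> l ln; rewrite mulr_ge0 ?powR_ge0 ?g0.
    - move=> l x ln lx; have [->|f0] := eqVneq (f x) 0.
        by rewrite normr0 powR0 ?gt_eqF// mulr_ge0 ?powR_ge0 ?g0.
      rewrite powE ?normr_gt0//; apply: ler_pM; rewrite ?powR_ge0 ?sqr_ge0//.
        apply: (@le_trans _ _ (B `^ (p - 2))).
          by rewrite ge0_ler_powR ?nnegrE ?subr_ge0 ?(fB l)// ltW.
        by apply: ler_powR => //; rewrite gerBl.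
      exact: fg ln lx.
    - by rewrite lee_fin -mulr_sumr -mulrA ler_wpM2l ?powR_ge0.
  rewrite lee_fin powRM ?powR_ge0 ?(ltW X0)// -powRrM divff ?gt_eqF// powRr1 ?(ltW B0)//.
  by rewrite ler_wpM2r ?powR_ge0//; lra.
rewrite (_ : Num.min _ _ = 2^-1); last first.
  by rewrite !div1r; apply/min_idPl; rewrite lef_pV2 ?posrE// ltW.
set eta := X `^ 2^-1.
have eta0 : 0 < eta by exact: powR_gt0.
have etaE : eta ^+ 2 = X.
  by rewrite sqrE ?(ltW eta0)// -powRrM mulVf// powRr1// ltW.
apply: (@le_trans _ _ ((2 * eta `^ p) `^ p^-1)%:E).
  apply: Lp_norm01_le => //; first by rewrite mulr_ge0 ?powR_ge0.
  apply: le_trans (@integral_cells_le n (fun l => eta `^ p + eta `^ (p - 2) * g l) _ n0 _ _ _) _.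
  - by move=> x; exact: powR_ge0.
  - by move=> l ln; rewrite addr_ge0 ?mulr_ge0 ?powR_ge0 ?g0.
  - move=> l x ln lx; have [fe|fe] := leP `|f x| eta.
      rewrite (@le_trans _ _ (eta `^ p))//.
        by rewrite ge0_ler_powR ?nnegrE// ?ltW.
      by rewrite lerDl mulr_ge0 ?powR_ge0 ?g0.
    rewrite ler_wpDl ?powR_ge0// powE; last exact: lt_trans fe.
    apply: ler_pM; rewrite ?powR_ge0 ?sqr_ge0//; last exact: fg ln lx.
    rewrite -(opprB 2 p) !powRN lef_pV2 ?posrE ?powR_gt0//; last exact: lt_trans fe.
    by rewrite ge0_ler_powR ?nnegrE ?subr_ge0 ?ltW//; exact: lt_trans fe.
  - rewrite lee_fin big_split/= sumr_const_nat subn0 -mulr_sumr mulrDl.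
    rewrite -[_ *+ n]mulr_natr mulfK ?gt_eqF// mulr2n mulrDl mul1r lerD2l.
    by rewrite powE// etaE -mulrA ler_wpM2l ?powR_ge0.
rewrite lee_fin powRM ?powR_ge0// -powRrM divff ?gt_eqF// powRr1 ?(ltW eta0)//.
rewrite ler_wpM2r ?(ltW eta0)//.
apply: (@le_trans _ _ 2); last by lra.
by apply: ler1_powR; rewrite ?invf_le1//; lra.
Qed.

End LpNorm.

(** Stands in for Jensen's inequality: the power of the random squared error is made affine before
    integration, with one term for [x <= x0] and one for [x > x0]. *)
Lemma powR_le_affine (R : realType) (x0 x theta : R) : 0 < x0 -> 0 <= x ->
  0 <= theta <= 1 -> x `^ theta <= x0 `^ theta + x0 `^ (theta - 1) * x.
Proof.
move=> x00 xge0 /andP[th0 th1]; have [xx|xx] := leP x x0.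
  rewrite ler_wpDr ?mulr_ge0 ?powR_ge0// ge0_ler_powR// ?nnegrE// ltW//.
have x_gt0 : 0 < x by exact: lt_trans xx.
rewrite ler_wpDl ?powR_ge0//.
have -> : x `^ theta = x `^ (theta - 1) * x.
  rewrite -[X in _ * X](powRr1 xge0) -powRD ?subrK//.
  by apply/implyP => _; exact: lt0r_neq0.
rewrite ler_wpM2r// -(opprB 1 theta) !powRN lef_pV2 ?posrE ?powR_gt0//.
by rewrite ge0_ler_powR ?nnegrE ?subr_ge0// ltW.
Qed.

Lemma le_big_rem (R : numDomainType) (I : eqType) (s : seq I) (F : I -> R) i :
  (forall j, 0 <= F j) -> i \in s -> F i <= \sum_(j <- s) F j.
Proof. by move=> F0 si; rewrite (big_rem i)//= lerDl sumr_ge0. Qed.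

Section Risk.
Context {R : realType} d (Omega : measurableType d) (P : probability Omega R).
Variables (n r : nat) (e : 'I_n -> {RV P >-> R}).
Hypothesis iid_e : iid_std_normal e.

Lemma integral_expsum_le (k t : R) s : 0 <= k ->
  (\int[P]_w (k * expsum t (ext (e ^~ w)) s)%:E <=
   (k * ((size s)%:R * (2 * expR (t ^+ 2 / 2))))%:E)%E.
Proof.
move=> k0; under eq_integral do rewrite EFinM.
have k0' : (0 <= k%:E)%E by rewrite lee_fin.
have me : measurable_fun setT (fun w => (expsum t (ext (e ^~ w)) s)%:E).
  by apply/measurable_EFinP; exact: measurable_expsum.
have e0 w : (0 <= (expsum t (ext (e ^~ w)) s)%:E)%E by rewrite lee_fin expsum_ge0.
rewrite ge0_integralZl// EFinM lee_wpmul2l//; exact: std_normal_expsum.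
Qed.

Lemma expsum_flatten (t : R) z (W : nat -> seq (nat * nat)) N :
  \sum_(0 <= k < N) expsum t z (W k) =
  expsum t z (flatten [seq W k | k <- index_iota 0 N]).
Proof. by rewrite /expsum big_flatten/= big_map. Qed.

Variables (nu epsilon L sigma T alpha p x x0 : R) (mu : stepfun R).
Variable est : n.-tuple R -> R -> R.
Local Notation K := (nchange mu).
Local Notation t := (tgrid mu n).
Local Notation q := (local_quantile P (fun i => e i : Omega -> R) alpha).
Local Notation theta := (Num.min (1 / 2) (1 / p)).
Hypotheses (n_gt0 : (0 < n)%N) (r_gt0 : (0 < r)%N) (p1 : 1 <= p).
Hypotheses (sigma0 : 0 < sigma) (epsL : 0 < epsilon < L) (T1 : 1 <= T).
Hypotheses (alpha01 : 0 < alpha < 1) (x_gt0 : 0 < x) (x0_gt0 : 0 < x0).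
Hypotheses (mu_class : stepclass nu epsilon L mu).
Hypothesis gap_r : (4 * r).+1%:R <= n%:R * nu.
Hypothesis penT : forall w k, (0 < w)%N -> (w <= k)%N -> (k <= n)%N ->
  pen (w%:R / k%:R : R) <= T.
Hypothesis rT : 8 * sigma * T < epsilon * Num.sqrt r%:R.
Hypothesis tail_alpha : (n * n.+1)%:R * (2 * expR (- T ^+ 2 / 2)) <= alpha.
Hypothesis est_FDRSeg : forall Y, is_FDRSeg sigma q Y (est Y).

Let tailT m : (0 < m)%N -> (m <= n)%N ->
  (P (exceed_event e 0 m (2 * T)) <= alpha%:E)%E.
Proof.
move=> m0 mn; apply: le_trans (exceed_event_tail iid_e m0 mn T1) _.
by rewrite lee_fin.
Qed.

Let qT k : (0 < k)%N -> (k <= n)%N -> q k <= 2 * T.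
Proof. by move=> k0 kn; apply: (local_quantile_le alpha01 k0 kn (tailT k0 kn)). Qed.

Let t_lt k : (k <= K)%N -> (t k < t k.+1 <= n)%N.
Proof.
move=> kK; have tl i : (i <= K)%N -> (t i < t i.+1)%N.
  move=> iK; case: mu_class => nug _.
  apply: leq_trans (tgrid_gap n_gt0 iK nug gap_r).
  by rewrite -addn1 leq_add2l muln_gt0.
by rewrite tl//= -{2}(tgrid_last mu n); exact: (incr_homo_le tl).
Qed.

Let L0 : 0 < L. Proof. by have /andP[] := epsL; exact: lt_trans. Qed.
(** [B] bounds the loss on the good event, by [2 * L] on the grid plus [L] inside a cell, enlarged
    by 1 so that [1 <= B]. [D] bounds the loss when single noise values are at most [T]. [E] is at
    least 1 as soon as some window exceeds [T], and [X] bounds the integrated squared error on the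
    good event. *)
Let B : R := 3 * L + 1.
Let D : R := (L + 4 * sigma) * T.
Let E w := expR (- T ^+ 2) * expsum T (ext (e ^~ w)) (all_windows n).
Let bad k := exceed_event e (t k) (t k.+1 - t k) (q (t k.+1 - t k)).
Let W := flatten [seq near_windows r t k | k <- index_iota 0 K.+1].
Let X w := (8 * sigma ^+ 2 * (K.+1%:R * (3 * x) +
   3 * c6 / x ^+ 2 * expsum 1 (ext (e ^~ w)) W) + 2 * L ^+ 2 * K%:R) / n%:R.

Let T0 : 0 < T. Proof. exact: lt_le_trans T1. Qed.
Let D0 : 0 <= D.
Proof. by rewrite mulr_ge0 ?(ltW T0)// addr_ge0 ?mulr_ge0 ?(ltW L0) ?(ltW sigma0). Qed.
Let B1 : 1 <= B. Proof. by rewrite lerDr mulr_ge0// ltW. Qed.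
Let n0' : 0 < n%:R :> R. Proof. by rewrite ltr0n. Qed.
Let E0 w : 0 <= E w. Proof. by rewrite mulr_ge0 ?expR_ge0 ?expsum_ge0. Qed.

Let cx0 : 0 <= 3 * c6 / x ^+ 2.
Proof. by rewrite divr_ge0 ?sqr_ge0// mulr_ge0// ltW// c6_gt0. Qed.

Let X_gt0 w : 0 < X w.
Proof.
have h1 : 0 < K.+1%:R * (3 * x) by rewrite mulr_gt0 ?ltr0n// mulr_gt0.
have h2 : 0 <= 3 * c6 / x ^+ 2 * expsum 1 (ext (e ^~ w)) W.
  by rewrite mulr_ge0 ?expsum_ge0.
have h3 : 0 < 8 * sigma ^+ 2 by rewrite mulr_gt0// exprn_gt0.
have h4 : 0 <= 2 * L ^+ 2 * K%:R by rewrite mulr_ge0// mulr_ge0// sqr_ge0.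
by rewrite divr_gt0// (ltr_wpDr h4)// mulr_gt0// (ltr_wpDr h2).
Qed.

Let loss w : \bar R :=
  Lp_norm01 p (fun x => est (observations mu sigma e w) x - stepval mu x).

Let est_w w : is_FDRSeg sigma q
  [tuple stepval mu (grid n i) + sigma * e i w | i < n]
  (est (observations mu sigma e w)).
Proof. exact: est_FDRSeg. Qed.

Let z_chi w l : ext (e ^~ w) l = chi (ext (e ^~ w)) l l.+1.
Proof. by rewrite /chi /wsum big_nat1 subSnn sqrtr1 divr1. Qed.

Let loss_sup w c : (forall l, (l < n)%N -> `|ext (e ^~ w) l| <= T * c) -> 1 <= c ->
  (loss w <= (D * c)%:E)%E.
Proof.
move=> zc c1; apply: (Lp_norm01_sup n_gt0 p1).
  by rewrite mulr_ge0// (le_trans _ c1).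
move=> l y ln ly; apply: le_trans
  (loss_le n_gt0 r_gt0 sigma0 epsL T1 mu_class gap_r penT qT rT (est_w w) ln ly) _.
have zl := zc l ln.
have h1 : 1 <= T * c by rewrite mulr_ege1.
have h2 : T <= T * c by rewrite ler_pMr.
have h3 : sigma * `|ext (e ^~ w) l| <= sigma * (T * c) by rewrite ler_pM2l.
have h4 : L * 1 <= L * (T * c) by rewrite ler_pM2l.
have h5 : sigma * T <= sigma * (T * c) by rewrite ler_pM2l.
have -> : D * c = L * (T * c) + 3 * (sigma * (T * c)) + sigma * (T * c).
  by rewrite /D; ring.
by rewrite mulr1 in h4; lra.
Qed.

Let loss_good w :
  (forall a b, (a < b)%N -> (b <= n)%N -> `|chi (ext (e ^~ w)) a b| <= T) ->
  (forall k, (k <= K)%N -> ~ bad k w) ->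
  (loss w <= (2 * B * X w `^ theta)%:E)%E.
Proof.
move=> zT feas; have [fL fX] := good_fit n_gt0 r_gt0 sigma0 epsL T1
  mu_class gap_r penT qT rT (est_w w) zT feas x_gt0.
set f := est _ in fL fX.
pose F l := f (grid n l) - stepval mu (grid n l).
pose J l : R := \sum_(1 <= k < K.+1) (t k == l.+1)%:R.
have J0 l : 0 <= J l by exact: sumr_ge0.
have nn : 2 <= n%:R * nu by apply: le_trans gap_r; rewrite ler_nat ltnS muln_gt0.
have cellE l y : (l < n)%N -> grid n l <= y < grid n l.+1 ->
    f y - stepval mu y = F l - (stepval mu y - stepval mu (grid n l)).
  move=> ln ly.
  have [fE _] := estimator_cell n_gt0 r_gt0 sigma0 epsL T1 gap_r penT qT rT (est_w w) ln ly.
  by rewrite -/f in fE; rewrite /F -fE; ring.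
apply: (@Lp_norm01_interpolation _ _ _ _ _ n (fun l => 2 * F l ^+ 2 + 2 * (L ^+ 2 * J l)))
  => //.
- move=> l _; have hJ := mulr_ge0 (sqr_ge0 L) (J0 l).
  by have := sqr_ge0 (F l); lra.
- move=> l y ln ly; rewrite /= -/f (cellE l y ln ly).
  have [_ h] := stepval_cell n_gt0 ln (ltW L0) mu_class nn ly.
  by apply: le_trans (ler_normB _ _) _; rewrite /B; have := fL l ln; rewrite -/(F l); lra.
- move=> l y ln ly; rewrite /= -/f (cellE l y ln ly) real_normK ?num_real//.
  have [h _] := stepval_cell n_gt0 ln (ltW L0) mu_class nn ly.
  rewrite real_normK ?num_real// in h; move: h; rewrite -/(J l).
  set u := _ - _ => h; have := sqr_ge0 (F l + u).
  have -> : (F l + u) ^+ 2 = 2 * F l ^+ 2 + 2 * u ^+ 2 - (F l - u) ^+ 2 by ring.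
  by move: h; lra.
rewrite /X ler_pM2r ?invr_gt0// big_split/= -!mulr_sumr.
(* The [k]-th change-point is counted by one cell at most, [l = (t k).-1]. *)
have sumJ : \sum_(0 <= l < n) J l <= K%:R.
  rewrite /J exchange_big/= [leRHS](_ : _ = \sum_(1 <= k < K.+1) 1); last first.
    by rewrite sumr_const_nat subn1.
  apply: ler_sum_nat => k _.
  have [tn|nt] := boolP (((t k).-1 \in index_iota 0 n) && (0 < t k)%N).
    case/andP: tn => tn tk0; rewrite (big_rem _ tn)/= prednK// eqxx.
    rewrite big_seq big1 ?addr0// => l; rewrite mem_rem_uniq ?iota_uniq// inE.
    by case/andP => lt _; case: eqP => // tl; move: lt; rewrite tl eqxx.
  rewrite big_nat big1 ?ler01// => l /andP[_ ln]; case: eqP => // tl.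
  by move: nt; rewrite tl/= mem_index_iota ln.
have L2 : 0 <= L ^+ 2 by exact: sqr_ge0.
have := ler_wpM2l L2 sumJ; move: fX; rewrite -/(F _).
rewrite big_split/= sumr_const_nat subn0 -mulr_sumr expsum_flatten -/W.
rewrite -[_ *+ K.+1]mulr_natl; under eq_bigr do rewrite -/(F _).
set S1 := \sum_(0 <= l < n) _; set S2 := _ + _; set S3 := \sum_(0 <= l < n) _.
rewrite !mulrA -![4 * _ * _]mulrA; lra.
Qed.

Let theta01 : 0 <= theta <= 1.
Proof.
have p0 : 0 < p by exact: lt_le_trans p1.
rewrite le_min ge_min !divr_ge0 ?(ltW p0)//=.
by apply/orP; left; rewrite ler_pdivrMr// mul1r ler1n.
Qed.

(** One term pays for each case: a window beyond [T], an infeasible true segment, the good event. In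
    the case of a large window, [T * E w] also bounds every single noise value, so the loss is at
    most [D * E w]. *)
Let loss_le_bound w :
  (loss w <= (D * E w + D * (\sum_(0 <= k < K.+1) \1_(bad k) w)
    + 2 * B * (x0 `^ theta + x0 `^ (theta - 1) * X w))%:E)%E.
Proof.
have S0 : 0 <= \sum_(0 <= k < K.+1) \1_(bad k) w :> R.
  by apply: sumr_ge0 => k _; rewrite indicE.
have X0 : 0 <= 2 * B * (x0 `^ theta + x0 `^ (theta - 1) * X w).
  have b0 : 0 <= 2 * B by rewrite mulr_ge0// (le_trans _ B1).
  have px : 0 <= x0 `^ (theta - 1) * X w.
    exact: mulr_ge0 (powR_ge0 _ _) (ltW (X_gt0 w)).
  by rewrite (mulr_ge0 b0)// addr_ge0// powR_ge0.
have DE0 : 0 <= D * E w by exact: mulr_ge0.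
have DS0 := mulr_ge0 D0 S0.
have [[a [b [ab bn Tc]]]|zT] :=
    pselect (exists a b, [/\ (a < b)%N, (b <= n)%N & T < `|chi (ext (e ^~ w)) a b|]).
  have E1 : 1 <= E w by exact: one_le_expsum T1 ab bn Tc.
  apply: le_trans (loss_sup _ E1) _; last by rewrite lee_fin -addrA lerDl addr_ge0.
  move=> l ln; rewrite z_chi.
  have [Tl|Tl] := ltP T `|chi (ext (e ^~ w)) l l.+1|.
    exact: tail_le_expsum T1 (ltnSn l) ln Tl.
  by rewrite (le_trans Tl)// ler_pMr.
have {}zT a b : (a < b)%N -> (b <= n)%N -> `|chi (ext (e ^~ w)) a b| <= T.
  by move=> ab bn; rewrite leNgt; apply/negP => Tc; apply: zT; exists a, b.
have [[k [kK badk]]|feas] := pselect (exists k, (k <= K)%N /\ bad k w).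
  apply: le_trans (@loss_sup w 1 _ (lexx _)) _.
    by move=> l ln; rewrite mulr1 z_chi; exact: zT.
  have S1 : 1 <= \sum_(0 <= k < K.+1) \1_(bad k) w :> R.
    have -> : 1 = \1_(bad k) w :> R by rewrite indicE mem_set.
    have kI : k \in index_iota 0 K.+1 by rewrite mem_index_iota.
    by apply: (le_big_rem (F := fun k => \1_(bad k) w)) => // i; rewrite indicE.
  rewrite lee_fin; apply: le_trans (ler_wpM2l D0 S1) _.
  by rewrite -addrA addrCA lerDl addr_ge0.
apply: le_trans (loss_good zT _) _.
  by move=> k kK badk; apply: feas; exists k.
have b0 : 0 <= 2 * B by rewrite mulr_ge0// (le_trans _ B1).
rewrite lee_fin.
apply: le_trans (ler_wpM2l b0 (powR_le_affine x0_gt0 (ltW (X_gt0 w)) theta01)) _.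
by rewrite lerDr addr_ge0.
Qed.

Let P_bad k : (k <= K)%N -> measurable (bad k) /\ (P (bad k) <= alpha%:E)%E.
Proof.
move=> kK; have /andP[tk tn] := t_lt kK.
have m0 : (0 < t k.+1 - t k)%N by rewrite subn_gt0.
have mn : (t k.+1 - t k <= n)%N by rewrite (leq_trans (leq_subr _ _)).
have am : (t k + (t k.+1 - t k) <= n)%N by rewrite subnKC// ltnW.
split; first exact: measurable_exceed_event.
rewrite /bad exceed_event_shift//.
exact: (local_quantile_level alpha01 m0 mn (tailT m0 mn)).
Qed.

(** The summand with [T] and [alpha] is the cost of the exceptional events, the other one comes from
    the good event; [r * r + (r + r)] is the number of windows listed per segment. *)
Definition risk_bound (K : nat) : R :=
  (L + 4 * sigma) * T * ((n * n.+1)%:R * (2 * expR (- T ^+ 2 / 2)) + K.+1%:R * alpha)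
  + 2 * (3 * L + 1) * (x0 `^ theta + x0 `^ (theta - 1) *
     ((8 * sigma ^+ 2 * (K.+1%:R * (3 * x) + 3 * c6 / x ^+ 2 *
        ((K.+1 * (r * r + (r + r)))%:R * (2 * expR (1 ^+ 2 / 2))))
        + 2 * L ^+ 2 * K%:R) / n%:R)).

Lemma Lp_risk_le : (Lp_risk P p sigma (fun i => e i : Omega -> R) est mu <=
  (risk_bound K)%:E)%E.
Proof.
have b0 : 0 <= 2 * B by rewrite mulr_ge0// (le_trans _ B1).
pose g1 w := D * E w; pose g2 w : R := \sum_(0 <= k < K.+1) D * \1_(bad k) w.
pose cW := 2 * B * (x0 `^ (theta - 1) * (8 * sigma ^+ 2 * (3 * c6 / x ^+ 2) / n%:R)).
pose g3 w := cW * expsum 1 (ext (e ^~ w)) W.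
pose c4 := 2 * B * (x0 `^ theta + x0 `^ (theta - 1) *
  ((8 * sigma ^+ 2 * (K.+1%:R * (3 * x)) + 2 * L ^+ 2 * K%:R) / n%:R)).
have s2 : 0 <= 8 * sigma ^+ 2 by rewrite mulr_ge0// sqr_ge0.
have cW0 : 0 <= cW.
  rewrite /cW; do 2 (apply: mulr_ge0 => //; rewrite ?powR_ge0//).
  by rewrite divr_ge0 ?(ltW n0')// mulr_ge0.
have c40 : 0 <= c4.
  have h1 : 0 <= K.+1%:R * (3 * x) by rewrite mulr_ge0 ?ler0n// mulr_ge0// ltW.
  have h2 : 0 <= 2 * L ^+ 2 * K%:R by rewrite mulr_ge0// mulr_ge0// sqr_ge0.
  rewrite /c4 (mulr_ge0 b0)// addr_ge0 ?powR_ge0// (mulr_ge0 (powR_ge0 _ _))//.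
  by rewrite (divr_ge0 _ (ltW n0'))// addr_ge0// mulr_ge0.
have g10 w : (0 <= (g1 w)%:E)%E by rewrite lee_fin; exact: mulr_ge0.
have g2k k w : 0 <= D * \1_(bad k) w by rewrite mulr_ge0// indicE.
have g20 w : (0 <= (g2 w)%:E)%E by rewrite lee_fin; exact: sumr_ge0.
have g30 w : (0 <= (g3 w)%:E)%E by rewrite lee_fin /g3 mulr_ge0 ?expsum_ge0.
have mg1 : measurable_fun setT (fun w => (g1 w)%:E).
  apply/measurable_EFinP; do 2 apply: measurable_funM => //.
  exact: measurable_expsum.
have mbad k : (k <= K)%N -> measurable_fun setT (fun w => D * \1_(bad k) w).
  move=> kK; apply: measurable_funM => //; apply: measurable_indic.
  exact: (P_bad kK).1.
have g2E w : g2 w = \sum_(k < K.+1) D * \1_(bad k) w by rewrite /g2 big_mkord.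
have mg2 : measurable_fun setT (fun w => (g2 w)%:E).
  apply/measurable_EFinP; rewrite (_ : g2 = fun w => \sum_(k < K.+1) D * \1_(bad k) w).
    by apply: measurable_sum => k; apply: mbad; exact: leq_ord.
  exact/funext.
have mg3 : measurable_fun setT (fun w => (g3 w)%:E).
  by apply/measurable_EFinP; apply: measurable_funM => //; exact: measurable_expsum.
apply: (@le_trans _ _ (\int[P]_w ((g1 w)%:E + (g2 w)%:E + (g3 w)%:E + c4%:E))%E).
  apply: ge0_le_integralT => w; first exact: Lnorm_ge0.
  apply: le_trans (loss_le_bound w) _; rewrite -!EFinD lee_fin le_eqVlt.
  apply/orP; left; apply/eqP; rewrite /g1 /g2 /g3 /cW /c4 /X -mulr_sumr.
  by rewrite -!addrA; congr (_ + (_ + _)); ring.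
have i1 : (\int[P]_w (g1 w)%:E <=
    (D * ((n * n.+1)%:R * (2 * expR (- T ^+ 2 / 2))))%:E)%E.
  rewrite /g1 /E; under eq_integral do rewrite mulrA.
  apply: le_trans (integral_expsum_le _ _ _) _.
    by rewrite mulr_ge0 ?expR_ge0.
  rewrite lee_fin size_all_windows -mulrA ler_wpM2l// mulrCA ler_wpM2l//.
  by rewrite mulrCA ler_wpM2l// -expRD ler_expR; lra.
have i2 : (\int[P]_w (g2 w)%:E <= (D * (K.+1%:R * alpha))%:E)%E.
  under eq_integral do rewrite g2E -sumEFin.
  rewrite ge0_integral_sum//; last first.
  - by move=> k w _; rewrite lee_fin.
  - by move=> k; apply/measurable_EFinP; apply: mbad; exact: leq_ord.
  apply: (@le_trans _ _ (\sum_(k < K.+1) (D * alpha))%:E).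
    rewrite -sumEFin; apply: lee_sum => k _; have [mb Pb] := P_bad (leq_ord k).
    under eq_integral do rewrite EFinM.
    have mi : measurable_fun setT (fun w => (\1_(bad k) w : R)%:E).
      by apply/measurable_EFinP; exact: measurable_indic.
    have i0 w : (0 <= (\1_(bad k) w : R)%:E)%E by rewrite lee_fin indicE.
    have D0' : (0 <= D%:E)%E by rewrite lee_fin.
    by rewrite ge0_integralZl// integral_indic// setIT (EFinM D alpha) lee_wpmul2l.
  by rewrite lee_fin sumr_const card_ord -(mulr_natl (D * alpha)) mulrCA.
have i3 := integral_expsum_le 1 W cW0.
have m12 : measurable_fun setT (fun w => (g1 w)%:E + (g2 w)%:E)%E.
  exact: emeasurable_funD.
have m123 : measurable_fun setT (fun w => (g1 w)%:E + (g2 w)%:E + (g3 w)%:E)%E.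
  exact: emeasurable_funD.
have g120 w : (0 <= (g1 w)%:E + (g2 w)%:E)%E by exact: adde_ge0.
have g1230 w : (0 <= (g1 w)%:E + (g2 w)%:E + (g3 w)%:E)%E by exact: adde_ge0.
have c40' : (0 <= c4%:E)%E by rewrite lee_fin.
rewrite !ge0_integralD// [X in (_ + X)%E]integral_cst// [X in (_ * X)%E]probability_setT mule1.
apply: le_trans (leeD (leeD (leeD i1 i2) i3) (lexx _)) _.
rewrite -!EFinD lee_fin le_eqVlt; apply/orP; left; apply/eqP.
have -> : size W = (K.+1 * (r * r + (r + r)))%N.
  rewrite size_flatten /shape -map_comp sumnE big_map.
  by under eq_bigr do rewrite /= size_near_windows; rewrite sum_nat_const_nat subn0.
by rewrite /risk_bound /cW /c4 /D /B; ring.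
Qed.

End Risk.

(** * Asymptotics *)

Section Growth.
Context {R : realType}.

Lemma near_powR_ge (u M : R) : 0 < u -> \forall n \near \oo, M <= n%:R `^ u.
Proof.
move=> u0; pose N := (Num.truncn (`|M| `^ u^-1)).+1.
near=> n.
have Nn : (N <= n)%N by near: n; exact: nbhs_infty_ge.
apply: le_trans (ler_norm M) _.
have -> : `|M| = (`|M| `^ u^-1) `^ u.
  by rewrite -powRrM mulVf ?gt_eqF// powRr1.
rewrite ge0_ler_powR ?nnegrE ?powR_ge0 ?(ltW u0)//.
by apply: le_trans (ltW (truncnS_gt _)) _; rewrite ler_nat.
Unshelve. all: by end_near. Qed.

Lemma near_ln_ge (M : R) : \forall n \near \oo, M <= ln (n%:R : R).
Proof.
near=> n; have : expR M <= n%:R `^ 1 by near: n; exact: near_powR_ge.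
rewrite powRr1// => h; rewrite -(expRK M) ler_ln// posrE ?expR_gt0//.
exact: lt_le_trans (expR_gt0 M) h.
Unshelve. all: by end_near. Qed.

Lemma near_ln_le_powR (s k : R) : 0 < s -> 0 < k ->
  \forall n \near \oo, ln (n%:R : R) <= k * n%:R `^ s.
Proof.
move=> s0 k0; have s20 : 0 < s / 2 by rewrite divr_gt0.
near=> n.
have n0 : 0 < (n%:R : R) by rewrite ltr0n; near: n; exact: nbhs_infty_gt.
have h : 2 / (s * k) <= n%:R `^ (s / 2) by near: n; exact: near_powR_ge.
have -> : n%:R `^ s = n%:R `^ (s / 2) * n%:R `^ (s / 2).
  by rewrite -powRD -splitr// gt_eqF.
(* [ln w < w] is used at the half power of [n]; the other half power absorbs the constant. *)
have := ln_sublinear (powR_gt0 (s / 2) n0); rewrite ln_powR => h1.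
have p0 : 0 <= (n%:R : R) `^ (s / 2) by exact: powR_ge0.
move: h h1 p0; set w := _ `^ _ => h h1 p0.
have h2 : ln n%:R <= 2 / s * w.
  have e1 : s / 2 * (2 / s) = 1 by field; rewrite gt_eqF.
  by rewrite -(ler_pM2l s20) mulrA e1 mul1r ltW.
apply: le_trans h2 _; rewrite mulrA ler_wpM2r//.
move: h; rewrite ler_pdivrMr ?mulr_gt0// => h.
by rewrite ler_pdivrMr//; lra.
Unshelve. all: by end_near. Qed.

Lemma limn_esup_le_near (u : nat -> \bar R) (c : \bar R) :
  (\forall n \near \oo, (u n <= c)%E) -> (limn_esup u <= c)%E.
Proof.
move=> uc; apply: le_trans (_ : ereal_sup (u @` [set n | (u n <= c)%E]) <= c)%E.
  by apply: ereal_inf_lbound; exists [set n | (u n <= c)%E].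
by apply: ge_ereal_sup => _ [n un <-].
Qed.

End Growth.

Lemma pen_le_sqrt_ln (R : realType) (n w k : nat) : 1 <= ln (n%:R : R) ->
  (0 < w)%N -> (w <= k)%N -> (k <= n)%N ->
  pen (w%:R / k%:R : R) <= Num.sqrt (8 * ln n%:R).
Proof.
move=> l1 w0 wk kn; apply: ler_wsqrtr.
have w0' : 0 < w%:R :> R by rewrite ltr0n.
have k0' : 0 < k%:R :> R by rewrite ltr0n (leq_trans w0).
have n0' : 0 < n%:R :> R by rewrite ltr0n (leq_trans w0)// (leq_trans wk).
rewrite invf_div lnM ?posrE ?expR_gt0 ?divr_gt0// expRK.
have : ln (k%:R / w%:R : R) <= ln n%:R.
  rewrite ler_ln ?posrE ?divr_gt0// ler_pdivrMr//.
  by rewrite -natrM ler_nat (leq_trans kn)// leq_pmulr.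
lra.
Qed.

Section RiskBoundAsymptotics.
Context {R : realType}.

(** [l] and [s] stand for ln n and n^(1 - gamma), so that the power [theta] of [rho] is the rate.
    The exceptional events and the good event each receive half of [delta]; the power is linearised
    at the scale [eta * rho]. *)
Lemma risk_bound_le (n r K : nat) (L sigma alpha p a A eta delta l s T : R) :
  (0 < n)%N -> (0 < r)%N -> 0 < L -> 0 < sigma -> 1 <= p -> 0 < a -> 0 < eta ->
  1 <= l -> 0 < s -> 0 <= T -> 0 < alpha -> 0 < delta -> r%:R <= A * l ->
  let theta := Num.min (1 / 2) (1 / p) in
  let rho := l / s in
  let C := (24 * sigma ^+ 2 + 1) / a in
  (n * n.+1)%:R * (2 * expR (- T ^+ 2 / 2)) <= alpha ->
  alpha <= s / (n%:R * Num.sqrt n%:R) * rho `^ theta ->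
  K.+1%:R * s * a <= n%:R ->
  4 * (L + 4 * sigma) * T <= delta * a * Num.sqrt n%:R ->
  72 * sigma ^+ 2 * c6 * A ^+ 2 * (2 * expR (1 ^+ 2 / 2)) / eta ^+ 2 + 2 * L ^+ 2
    <= eta * l ->
  2 * (3 * L + 1) * (1 + C) * eta `^ theta <= delta / 2 ->
  risk_bound n r L sigma T alpha p (eta * l) (eta * rho) K <= delta * rho `^ theta.
Proof.
move=> n0 r0 L0 s0 p1 a0 eta0 l1 sc0 T0 al0 d0 rA theta rho C tail al Ks Tn big fit.
have n0' : 0 < n%:R :> R by rewrite ltr0n.
have sn0 : 0 < Num.sqrt n%:R :> R by rewrite sqrtr_gt0.
have l0 : 0 < l by exact: lt_le_trans l1.
have rho0 : 0 < rho by rewrite divr_gt0.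
have K0 : 0 < K.+1%:R :> R by rewrite ltr0n.
have pr0 : 0 < rho `^ theta by exact: powR_gt0.
have LS : 0 <= L + 4 * sigma by rewrite addr_ge0 ?mulr_ge0 ?ltW.
have part1 : (L + 4 * sigma) * T *
   ((n * n.+1)%:R * (2 * expR (- T ^+ 2 / 2)) + K.+1%:R * alpha) <=
   delta / 2 * rho `^ theta.
  have LT : 0 <= (L + 4 * sigma) * T by exact: mulr_ge0.
  (* The tail term is at most [alpha], hence at most [K.+1%:R * alpha]: both exceptional events
     share one bound. *)
  have h1 : alpha <= K.+1%:R * alpha by rewrite ler_peMl ?ler1n// ltW.
  have h2 : K.+1%:R * alpha <= (a * Num.sqrt n%:R)^-1 * rho `^ theta.
    apply: (@le_trans _ _ (K.+1%:R * (s / (n%:R * Num.sqrt n%:R) * rho `^ theta))).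
      by rewrite ler_pM2l.
    rewrite mulrA ler_pM2r//.
    rewrite -(ler_pM2r (_ : 0 < a * (n%:R * Num.sqrt n%:R))) ?mulr_gt0//.
    rewrite [leLHS](_ : _ = K.+1%:R * s * a); last first.
      by field; rewrite !gt_eqF.
    rewrite [leRHS](_ : _ = n%:R)//.
    by field; rewrite !gt_eqF.
  apply: le_trans (ler_wpM2l LT (lerD (le_trans tail h1) (lexx _))) _.
  apply: le_trans (ler_wpM2l LT (lerD h2 h2)) _.
  rewrite -mulrDl mulrA ler_pM2r//.
  rewrite -(ler_pM2r (_ : 0 < 2 * (a * Num.sqrt n%:R))) ?mulr_gt0//.
  rewrite [leLHS](_ : _ = 4 * (L + 4 * sigma) * T); last first.
    by field; rewrite !gt_eqF.
  by apply: le_trans Tn _; rewrite le_eqVlt; apply/orP; left; apply/eqP; field.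
set x := eta * l; set x0 := eta * rho.
have x_gt0 : 0 < x by rewrite mulr_gt0.
have x0_gt0 : 0 < x0 by rewrite mulr_gt0.
set E := 2 * expR (1 ^+ 2 / 2) in big *.
have E0 : 0 < E by rewrite mulr_gt0// expR_gt0.
have c60 : 0 < c6 :> R by exact: c6_gt0.
set Q := (8 * sigma ^+ 2 * (K.+1%:R * (3 * x) + 3 * c6 / x ^+ 2 *
   ((K.+1 * (r * r + (r + r)))%:R * E)) + 2 * L ^+ 2 * K%:R) / n%:R.
(* Per segment, [24 * sigma ^+ 2 * x] comes from the three pieces and [big] hides all the rest under
   one more [x]; having at most [n / (s * a)] segments then gives [C]. *)
have QC : Q <= C * x0.
  have r1 : 1 <= r%:R :> R by rewrite ler1n.
  have r2 : (r * r + (r + r))%:R <= 3 * (A * l) ^+ 2 :> R.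
    rewrite !natrD natrM.
    have h : r%:R ^+ 2 <= (A * l) ^+ 2 by rewrite ler_sqr ?nnegrE// (le_trans _ rA).
    have h' : 0 <= (r%:R - 1) * r%:R :> R by rewrite mulr_ge0// subr_ge0.
    by rewrite expr2 in h; lra.
  have c0 : 0 <= 3 * c6 / x ^+ 2 * (K.+1%:R * E).
    have h1 : 0 <= 3 * c6 :> R by rewrite mulr_ge0// ltW.
    by rewrite (mulr_ge0 (divr_ge0 h1 (sqr_ge0 _)))// mulr_ge0// ltW.
  have t2 : 3 * c6 / x ^+ 2 * ((K.+1 * (r * r + (r + r)))%:R * E) <=
      K.+1%:R * (9 * c6 * A ^+ 2 * E / eta ^+ 2).
    rewrite natrM (_ : _ * (_ * _ * E) =
      3 * c6 / x ^+ 2 * (K.+1%:R * E) * (r * r + (r + r))%:R); last by ring.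
    apply: le_trans (ler_wpM2l c0 r2) _; rewrite le_eqVlt; apply/orP; left; apply/eqP.
    by rewrite /x; field; rewrite !gt_eqF.
  have s2 : 0 <= 8 * sigma ^+ 2 by rewrite mulr_ge0// sqr_ge0.
  have KK : K%:R <= K.+1%:R :> R by rewrite ler_nat.
  have L2 : 0 <= 2 * L ^+ 2 by rewrite mulr_ge0// sqr_ge0.
  have num : Q * n%:R <= K.+1%:R * ((24 * sigma ^+ 2 + 1) * x).
    rewrite /Q divfK ?gt_eqF//.
    have t3 := ler_wpM2l s2 t2; have t4 := ler_wpM2l L2 KK.
    have t5 := ler_wpM2l (ltW K0) big.
    rewrite mulrDr; apply: le_trans (lerD (lerD (lexx _) t3) t4) _.
    rewrite -/x in t5.
    apply: le_trans (_ : K.+1%:R * (24 * sigma ^+ 2 * x) + K.+1%:R * x <= _); last first.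
      by rewrite le_eqVlt; apply/orP; left; apply/eqP; ring.
    rewrite -addrA; apply: lerD.
      by rewrite le_eqVlt; apply/orP; left; apply/eqP; ring.
    apply: le_trans t5; rewrite le_eqVlt; apply/orP; left; apply/eqP; ring.
  rewrite -(ler_pM2r n0'); apply: le_trans num _.
  have sx0 : 0 <= (24 * sigma ^+ 2 + 1) * x.
    by rewrite mulr_ge0 ?(ltW x_gt0)// addr_ge0// mulr_ge0// sqr_ge0.
  rewrite -(ler_pM2r (mulr_gt0 sc0 a0)).
  rewrite [leLHS](_ : _ = K.+1%:R * s * a * ((24 * sigma ^+ 2 + 1) * x)); last by ring.
  apply: le_trans (ler_wpM2r sx0 Ks) _; rewrite le_eqVlt; apply/orP; left; apply/eqP.
  by rewrite /C /x0 /rho /x; field; rewrite !gt_eqF.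
have part2 : 2 * (3 * L + 1) * (x0 `^ theta + x0 `^ (theta - 1) * Q) <=
    delta / 2 * rho `^ theta.
  have B0 : 0 <= 2 * (3 * L + 1) by rewrite mulr_ge0// addr_ge0// mulr_ge0// ltW.
  have h : x0 `^ (theta - 1) * Q <= C * x0 `^ theta.
    apply: le_trans (ler_wpM2l (powR_ge0 _ _) QC) _.
    rewrite mulrCA ler_wpM2l//.
      by rewrite divr_ge0 ?(ltW a0)// addr_ge0// mulr_ge0// sqr_ge0.
    rewrite -[X in _ * X](powRr1 (ltW x0_gt0)) -powRD ?subrK//.
    by apply/implyP => _; exact: lt0r_neq0.
  apply: le_trans (ler_wpM2l B0 (lerD (lexx _) h)) _.
  have -> : x0 `^ theta + C * x0 `^ theta = (1 + C) * x0 `^ theta by ring.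
  rewrite mulrA /x0 powRM ?(ltW eta0) ?(ltW rho0)// mulrA.
  by rewrite ler_pM2r.
rewrite /risk_bound -/theta -/E -/Q.
have -> : delta * rho `^ theta = delta / 2 * rho `^ theta + delta / 2 * rho `^ theta.
  by field.
exact: lerD.
Qed.

End RiskBoundAsymptotics.

Section SupRisk.
Context {R : realType} d (Omega : measurableType d) (P : probability Omega R).

(** As T^2 = 8 ln n, the exponential is n^-4, and n (n + 1) <= 2 n^2 leaves 4 / n^2, which is below
    c n^(-3/2) once n^(1/2) >= 4 / c. *)
Lemma expR_tail_le (n : nat) (c alpha : R) : (0 < n)%N -> 1 <= ln (n%:R : R) ->
  0 < c -> 4 / c <= n%:R `^ (1 / 2) -> c * n%:R `^ (- (3 / 2)) <= alpha ->
  (n * n.+1)%:R * (2 * expR (- Num.sqrt (8 * ln n%:R) ^+ 2 / 2)) <= alpha.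
Proof.
move=> n0 l1 c0 cn; apply: le_trans.
have n0' : 0 < n%:R :> R by rewrite ltr0n.
rewrite sqr_sqrtr; last by rewrite mulr_ge0// (le_trans _ l1).
rewrite (_ : - (8 * ln n%:R) / 2 = - (4%:R * ln n%:R)); last by field.
rewrite expRN expRM_natl lnK ?posrE//.
have -> : n%:R `^ (- (3 / 2)) = n%:R `^ (1 / 2) / n%:R ^+ 2 :> R.
  rewrite -(powR_mulrn 2 (ltW n0')) -powRB; last first.
    by apply/implyP => _; exact: lt0r_neq0.
  by congr (_ `^ _); field.
have h : (n * n.+1)%:R <= 2 * n%:R ^+ 2 :> R.
  by rewrite expr2 -natrM -natrM ler_nat; nia.
have n2 : 0 < n%:R ^+ 2 :> R by rewrite exprn_gt0.
apply: (@le_trans _ _ (4 / n%:R ^+ 2)).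
  apply: (@le_trans _ _ (2 * n%:R ^+ 2 * (2 / n%:R ^+ 4))).
    by rewrite ler_wpM2r// divr_ge0// exprn_ge0// ltW.
  by rewrite le_eqVlt; apply/orP; left; apply/eqP; field; rewrite gt_eqF.
rewrite mulrA ler_pM2r ?invr_gt0//.
by move: cn; rewrite ler_pdivrMr// mulrC.
Qed.

Lemma sup_risk_near (eps : forall n : nat, 'I_n -> {RV P >-> R})
    (eps_iid : forall n : nat, iid_std_normal (eps n))
    (sigma a gamma epsilon L p c delta : R) (nu alpha : nat -> R)
    (muhat : forall n : nat, n.-tuple R -> R -> R) :
  let theta := Num.min (1 / 2) (1 / p) in
  0 < sigma -> 0 < a -> 0 <= gamma < 1 -> 0 < epsilon < L -> 1 <= p ->
  0 < c -> 0 < delta ->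
  (forall n, (0 < n)%N -> a * n%:R `^ (- gamma) <= nu n) ->
  (forall n, (0 < n)%N -> 0 < alpha n < 1) ->
  FDRSeg_estimator P eps sigma alpha muhat ->
  (forall n, (0 < n)%N -> c * n%:R `^ (- (3 / 2)) <= alpha n) ->
  (\forall n \near \oo, alpha n <=
     1 / n%:R `^ (gamma + 1 / 2) * (ln n%:R / n%:R `^ (1 - gamma)) `^ theta) ->
  \forall n \near \oo,
    (sup_risk P (stepclass (nu n) epsilon L) p sigma (eps n) (muhat n)
      <= (delta * (ln n%:R / n%:R `^ (1 - gamma)) `^ theta)%:E)%E.
Proof.
move=> theta s0 a0 /andP[g0 g1] epsL p1 c0 d0 nuP alphaP est alpha_ge alpha_le.
have /andP[e0 eL] := epsL; have L0 : 0 < L by exact: lt_trans eL.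
have p0 : 0 < p by exact: lt_le_trans p1.
have theta0 : 0 < theta by rewrite /theta lt_min !divr_gt0.
have LS : 0 < L + 4 * sigma by rewrite addr_gt0// mulr_gt0.
(* Condition [rT], squared, asks that [r] exceed [8 * (8 * sigma) ^+ 2 / epsilon ^+ 2] times ln n;
   the added 1 pays for rounding up, as ln n >= 1. *)
pose A := 8 * (8 * sigma) ^+ 2 / epsilon ^+ 2 + 1.
have A1 : 0 < A.
  by rewrite /A ltr_wpDl// divr_ge0 ?sqr_ge0// mulr_ge0// sqr_ge0.
pose C := (24 * sigma ^+ 2 + 1) / a.
have C0 : 0 <= C.
  by rewrite /C divr_ge0 ?(ltW a0)// addr_ge0// mulr_ge0// sqr_ge0.
pose M := 2 * (3 * L + 1) * (1 + C).
have M0 : 0 < M.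
  by rewrite /M mulr_gt0 ?ltr_pwDl// mulr_gt0// addr_gt0// mulr_gt0.
(* [eta] is chosen so that [M] times its power [theta] is [delta / 2], the share of the good
   event. *)
pose eta := (delta / (2 * M)) `^ theta^-1.
have dM : 0 < delta / (2 * M) by rewrite divr_gt0// mulr_gt0.
have eta0 : 0 < eta by exact: powR_gt0.
have etaE : M * eta `^ theta = delta / 2.
  rewrite /eta -powRrM mulVf ?gt_eqF// powRr1 ?(ltW dM)//.
  by field; rewrite gt_eqF.
pose big := 72 * sigma ^+ 2 * c6 * A ^+ 2 * (2 * expR (1 ^+ 2 / 2)) / eta ^+ 2
  + 2 * L ^+ 2.
(* [k] is the constant in the requirement T <= k sqrt(n), that is, 8 ln n <= k^2 n. *)
pose k := delta * a / (4 * (L + 4 * sigma)).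
have k0 : 0 < k by rewrite divr_gt0// mulr_gt0.
have A4 : 0 < 4 * A + 1 by rewrite addr_gt0// mulr_gt0.
near=> n.
have n0 : (0 < n)%N by near: n; exact: nbhs_infty_gt.
have n0' : 0 < n%:R :> R by rewrite ltr0n.
have l1 : 1 <= ln (n%:R : R) by near: n; exact: near_ln_ge.
have l0 : 0 < ln (n%:R : R) by exact: lt_le_trans l1.
have lbig : big / eta <= ln n%:R by near: n; exact: near_ln_ge.
have lgap : ln n%:R <= a / (4 * A + 1) * n%:R `^ (1 - gamma).
  near: n; apply: near_ln_le_powR; rewrite ?divr_gt0//; lra.
have lT : ln n%:R <= k ^+ 2 / 8 * n%:R `^ 1.
  by near: n; apply: near_ln_le_powR; rewrite ?divr_gt0 ?exprn_gt0.
have nc : 4 / c <= n%:R `^ (1 / 2) by near: n; exact: near_powR_ge.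
have al : alpha n <=
     1 / n%:R `^ (gamma + 1 / 2) * (ln n%:R / n%:R `^ (1 - gamma)) `^ theta.
  by near: n.
rewrite powRr1 ?(ltW n0')// in lT.
set l := ln n%:R in l1 l0 lbig lgap lT al *.
set s := n%:R `^ (1 - gamma) in lgap al *.
have sc0 : 0 < s by exact: powR_gt0.
pose T := Num.sqrt (8 * l).
have T0 : 0 <= T by exact: sqrtr_ge0.
have TE : T ^+ 2 = 8 * l by rewrite sqr_sqrtr// mulr_ge0// ltW.
have T1 : 1 <= T.
  have h8 : 1 <= 8 * l by rewrite mulr_ege1 ?ler1n.
  by rewrite /T -[leLHS]sqrtr1 ler_wsqrtr.
pose y := 8 * (8 * sigma) ^+ 2 / epsilon ^+ 2 * l.
have y0 : 0 <= y.
  by rewrite mulr_ge0 ?(ltW l0)// divr_ge0 ?sqr_ge0// mulr_ge0// sqr_ge0.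
pose r := (Num.truncn y).+1.
have rA : r%:R <= A * l.
  have /andP[h _] := truncn_itv y0.
  rewrite /r -natr1 /A mulrDl mul1r; exact: lerD.
have rT : 8 * sigma * T < epsilon * Num.sqrt r%:R.
  have h := truncnS_gt y; rewrite -/r in h.
  rewrite -ltr_sqr ?nnegrE ?mulr_ge0 ?sqrtr_ge0 ?(ltW s0) ?(ltW e0)//.
  rewrite !exprMn TE sqr_sqrtr ?ler0n//.
  have e2 : 0 < epsilon ^+ 2 by rewrite exprn_gt0.
  have {}h : epsilon ^+ 2 * y < epsilon ^+ 2 * r%:R by rewrite ltr_pM2l.
  apply: le_lt_trans h; rewrite /y.
  by rewrite le_eqVlt; apply/orP; left; apply/eqP; field; rewrite gt_eqF.
have sE : s = n%:R * n%:R `^ (- gamma).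
  rewrite /s powRB ?powRr1 ?powRN ?(ltW n0')//.
  by apply/implyP => _; exact: lt0r_neq0.
(* True segments contain polynomially many sampling points and [r] is logarithmic; this uses
   [gamma < 1]. *)
have gap_r : (4 * r).+1%:R <= n%:R * nu n.
  apply: (@le_trans _ _ ((4 * A + 1) * l)).
    have -> : (4 * A + 1) * l = 4 * (A * l) + l by ring.
    by rewrite -[(4 * r).+1%:R]natr1 natrM lerD// ler_pM2l.
  apply: (@le_trans _ _ (a * s)).
    by move: lgap; rewrite mulrAC ler_pdivlMr// mulrC.
  by rewrite sE mulrCA ler_pM2l// nuP.
have tail := expR_tail_le n0 l1 c0 nc (alpha_ge n n0).
have /andP[al0 al1] := alphaP n n0.
apply: ge_ereal_sup => _ [mu mu_class <-].
have [estP _] := est n n0.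
have risk := (Lp_risk_le (eps_iid n) n0 (ltn0Sn _ : (0 < r)%N) p1 s0 epsL T1
  (alphaP n n0) (mulr_gt0 eta0 l0) (mulr_gt0 eta0 (divr_gt0 l0 sc0)) mu_class gap_r
  (fun w k => @pen_le_sqrt_ln R n w k l1) rT tail estP).
apply: le_trans risk _; rewrite lee_fin.
apply: (risk_bound_le n0 _ L0 s0 p1 a0 eta0 l1 sc0 T0 al0 d0 rA) => //.
- apply: le_trans al _; rewrite ler_wpM2r ?powR_ge0// le_eqVlt; apply/orP; left.
  apply/eqP; rewrite powRD; last first.
    by apply/implyP => _; exact: lt0r_neq0.
  rewrite (_ : 1 / 2 = 2^-1) ?div1r// powR12_sqrt ?(ltW n0')// sE powRN.
  field; rewrite !gt_eqF ?sqrtr_gt0 ?powR_gt0//.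
- have K1 := stepclass_nchange mu_class.
  have nun := nuP n n0.
  have K0 : 0 <= (nchange mu).+1%:R :> R by exact: ler0n.
  have := le_trans (ler_wpM2l K0 nun) K1; rewrite -(ler_pM2l n0') mulr1.
  by apply: le_trans; rewrite sE le_eqVlt; apply/orP; left; apply/eqP; ring.
- have kE : 4 * (L + 4 * sigma) * k = delta * a.
    by rewrite /k mulrC divfK// gt_eqF// mulr_gt0.
  rewrite -kE -(mulrA _ k) ler_pM2l ?mulr_gt0//.
  have ks := mulr_ge0 (ltW k0) (sqrtr_ge0 n%:R).
  rewrite -ler_sqr ?nnegrE//.
  by rewrite exprMn TE sqr_sqrtr ?ler0n// mulrC -ler_pdivlMr// mulrAC.
- by rewrite (mulrC eta l) -ler_pdivrMr.
- by rewrite -etaE.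
Unshelve. all: by end_near. Qed.

(** [kappa] collects the constants of the normalisation; the choice of [delta] as [B] over the power
    [theta] of [kappa] makes the normalised bound exactly [B]. *)
Lemma normalized_sup_risk_near (eps : forall n : nat, 'I_n -> {RV P >-> R})
    (eps_iid : forall n : nat, iid_std_normal (eps n))
    (sigma a gamma epsilon L p c kappa B : R)
    (nu alpha factor : nat -> R) (muhat : forall n : nat, n.-tuple R -> R -> R) :
  let theta := Num.min (1 / 2) (1 / p) in
  0 < sigma -> 0 < a -> 0 <= gamma < 1 -> 0 < epsilon < L -> 1 <= p ->
  0 < c -> 0 < kappa -> 0 < B ->
  (forall n, (0 < n)%N -> a * n%:R `^ (- gamma) <= nu n) ->
  (forall n, (0 < n)%N -> 0 < alpha n < 1) ->
  FDRSeg_estimator P eps sigma alpha muhat ->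
  (forall n, (0 < n)%N -> c * n%:R `^ (- (3 / 2)) <= alpha n) ->
  alpha =o_\oo (fun n : nat => 1 / n%:R `^ (gamma + 1 / 2) *
    (ln n%:R / n%:R `^ (1 - gamma)) `^ theta) ->
  (forall n, (0 < n)%N -> factor n = kappa * (n%:R `^ (1 - gamma) / ln n%:R)) ->
  (limn_esup (fun n : nat =>
     sup_risk P (stepclass (nu n) epsilon L) p sigma (eps n) (muhat n)
     * (factor n `^ theta)%:E) <= B%:E)%E.
Proof.
move=> theta s0 a0 g01 epsL p1 c0 k0 B0 nuP alphaP est alpha_ge alpha_o factorE.
have kt0 : 0 < kappa `^ theta by exact: powR_gt0.
have d0 : 0 < B / kappa `^ theta by exact: divr_gt0.
have alpha_le : \forall n \near \oo, alpha n <=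
     1 / n%:R `^ (gamma + 1 / 2) * (ln n%:R / n%:R `^ (1 - gamma)) `^ theta.
  move/eqoP : alpha_o => /(_ 1 ltr01) alpha_o.
  near=> n; apply: le_trans (ler_norm _) _.
  have : `|alpha n| <= 1 * `|1 / n%:R `^ (gamma + 1 / 2) *
    (ln n%:R / n%:R `^ (1 - gamma)) `^ theta| by near: n.
  by rewrite mul1r [`|_ * _|]ger0_norm// mulr_ge0 ?powR_ge0// divr_ge0 ?powR_ge0.
have near_bound := sup_risk_near eps_iid s0 a0 g01 epsL p1 c0 d0 nuP alphaP est alpha_ge alpha_le.
apply: limn_esup_le_near; near=> n.
have n0 : (0 < n)%N by near: n; exact: nbhs_infty_gt.
have l1 : 1 <= ln (n%:R : R) by near: n; exact: near_ln_ge.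
have l0 : 0 < ln (n%:R : R) by exact: lt_le_trans l1.
have sc0 : 0 < n%:R `^ (1 - gamma) :> R by rewrite powR_gt0// ltr0n.
have bound : (sup_risk P (stepclass (nu n) epsilon L) p sigma (eps n) (muhat n)
    <= (B / kappa `^ theta * (ln n%:R / n%:R `^ (1 - gamma)) `^ theta)%:E)%E.
  by near: n.
apply: le_trans (lee_wpmul2r _ bound) _; first by rewrite lee_fin powR_ge0.
rewrite -EFinM lee_fin factorE// (@powRM _ kappa) ?(ltW k0) ?divr_ge0 ?(ltW l0) ?(ltW sc0)//.
rewrite mulrACA divfK ?gt_eqF// -powRM ?divr_ge0 ?(ltW l0) ?(ltW sc0)//.
rewrite (_ : _ / _ * (_ / _) = 1) ?powR1 ?mulr1//.
by field; rewrite !gt_eqF.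
Unshelve. all: by end_near. Qed.

End SupRisk.

(** Turns the lower bound on [alpha] of part (i) into the one of part (ii). *)
Lemma powR_neg_half3_le (R : realType) (C : R) (n : nat) : (0 < n)%N -> 0 < C ->
  C * n%:R `^ (- (3 / 2)) <= C * (1 / n%:R).
Proof.
move=> n0 C0; rewrite ler_pM2l// div1r -(powR_inv1 (ler0n R n)).
by apply: ler_powR; rewrite ?ler1n//; lra.
Qed.

Theorem theorem3p3 (R : realType) (d : measure_display)
    (Omega : measurableType d) (P : probability Omega R)
    (eps : forall n : nat, 'I_n -> {RV P >-> R})
    (eps_iid : forall n : nat, iid_std_normal (eps n)) :
  (forall (sigma nu epsilon L p : R) (alpha : nat -> R)
      (muhat : forall n : nat, n.-tuple R -> R -> R),
    0 < sigma -> 0 < nu < 1 / 2 -> 0 < epsilon < L -> 1 <= p ->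
    (forall n : nat, (0 < n)%N -> 0 < alpha n < 1) ->
    FDRSeg_estimator P eps sigma alpha muhat ->
    asymp_ge alpha (fun n => 1 / n%:R) ->
    alpha =o_\oo (fun n : nat => 1 / Num.sqrt n%:R *
      (ln n%:R / n%:R) `^ Num.min (1 / 2) (1 / p)) ->
    (limn_esup (fun n : nat =>
        sup_risk P (stepclass nu epsilon L) p sigma (eps n) (muhat n)
        * ((nu * epsilon ^+ 2 * n%:R / (sigma ^+ 2 * ln n%:R))
             `^ Num.min (1 / 2) (1 / p))%:E)
      <= (25 * L)%:E)%E)
  /\
  (forall (sigma a b gamma epsilon L p : R) (nu alpha : nat -> R)
      (muhat : forall n : nat, n.-tuple R -> R -> R),
    0 < sigma -> 0 < a -> 0 < b -> 0 < gamma < 1 -> 0 < epsilon < L ->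
    1 <= p ->
    (forall n : nat, (0 < n)%N ->
       a * n%:R `^ (- gamma) <= nu n <= b * n%:R `^ (- gamma)) ->
    (forall n : nat, (0 < n)%N -> 0 < alpha n < 1) ->
    FDRSeg_estimator P eps sigma alpha muhat ->
    asymp_ge alpha (fun n => n%:R `^ (- (3 / 2))) ->
    alpha =o_\oo (fun n : nat => 1 / n%:R `^ (gamma + 1 / 2) *
      (ln n%:R / n%:R `^ (1 - gamma)) `^ Num.min (1 / 2) (1 / p)) ->
    (limn_esup (fun n : nat =>
        sup_risk P (stepclass (nu n) epsilon L) p sigma (eps n) (muhat n)
        * ((epsilon ^+ 2 * n%:R `^ (1 - gamma) / (sigma ^+ 2 * ln n%:R))
             `^ Num.min (1 / 2) (1 / p))%:E)
      <= (34 * L)%:E)%E).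
Proof.
split.
- move=> sigma nu epsilon L p alpha muhat s0 /andP[nu0 nu1] epsL p1 alphaP est.
  move=> [C C0 alpha_ge] alpha_o; have /andP[e0 eL] := epsL.
  have L0 : 0 < L by exact: lt_trans eL.
  have powE (n : nat) : n%:R `^ (1 - 0) = n%:R :> R by rewrite subr0 powRr1.
  (* A constant [nu] is the case [gamma = 0], [a = nu]; in the normalisation it is part of
     [kappa]. *)
  apply: (@normalized_sup_risk_near _ _ _ _ _ eps_iid sigma nu 0 epsilon L p C
    (nu * epsilon ^+ 2 / sigma ^+ 2) (25 * L) (fun=> nu) alpha
    (fun n => nu * epsilon ^+ 2 * n%:R / (sigma ^+ 2 * ln n%:R)) muhat) => //.
  + by rewrite lexx ltr01.
  + by rewrite divr_gt0 ?mulr_gt0 ?exprn_gt0.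
  + by rewrite mulr_gt0.
  + by move=> n n0; rewrite oppr0 powRr0 mulr1.
  + by move=> n n0; apply: le_trans (alpha_ge n n0); exact: powR_neg_half3_le.
  + rewrite (_ : (fun n => _) = fun n : nat => 1 / Num.sqrt n%:R *
      (ln n%:R / n%:R) `^ Num.min (1 / 2) (1 / p)) //.
    apply/funext => n; rewrite powE add0r; congr (1 / _ * _).
    by rewrite div1r powR12_sqrt.
  + by move=> n n0; rewrite powE invfM; ring.
- move=> sigma a b gamma epsilon L p nu alpha muhat s0 a0 b0 /andP[g0 g1] epsL p1.
  move=> nuP alphaP est [C C0 alpha_ge] alpha_o; have /andP[e0 eL] := epsL.
  have L0 : 0 < L by exact: lt_trans eL.
  apply: (@normalized_sup_risk_near _ _ _ _ _ eps_iid sigma a gamma epsilon L p C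
    (epsilon ^+ 2 / sigma ^+ 2) (34 * L) nu alpha
    (fun n => epsilon ^+ 2 * n%:R `^ (1 - gamma) / (sigma ^+ 2 * ln n%:R)) muhat)
    => //.
  + by rewrite ltW.
  + by rewrite divr_gt0 ?exprn_gt0.
  + by rewrite mulr_gt0.
  + by move=> n n0; have /andP[] := nuP n n0.
  + by move=> n n0; rewrite invfM; ring.
Qed.
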